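(* Let $G$ be a discrete group acting on a directed graph $E=(E^0,E^1,r,s)$, and let $\varphi\colon G\times E^1\to G$ be a cocycle for this action. Let $\{P_v,S_e,U_g\}$ be a representation of $(E,G,\varphi)$ in a $C^*$-algebra $D$. Then there is a unique surjective homomorphism $\Phi$ from the Toeplitz algebra $\mathcal T_{Y^\varphi}$ onto $D$ such that \[ \Phi(p_v)=P_v,\quad \Phi(s_e)=S_e,\quad\text{and}\quad \overline{\Phi}(u_g)=U_g \] for all $v\in E^0$, $e\in E^1$, and $g\in G$, where $\overline\Phi\colon M(\mathcal T_{Y^\varphi})\to M(D)$ is the canonical extension of $\Phi$ to multiplier algebras, and $p_v=t_B(i_A(\delta_v))$, $s_e=t_{Y^\varphi}(\chi_{e,1})$, $u_g=\overline{t_B}(i_G(g))$ are the canonical elements described in the context.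
   Context: An action of $G$ on the directed graph $E$ is an action on the sets $E^0$ and $E^1$ with $r(ge)=g\,r(e)$, $s(ge)=g\,s(e)$. A cocycle for the action is a map $\varphi\colon G\times E^1\to G$ with $\varphi(gh,e)=\varphi(g,he)\varphi(h,e)$ and $\varphi(g,e)s(e)=g\,s(e)$ for all $g,h\in G$, $e\in E^1$. A Toeplitz $E$-family in a $C^*$-algebra $D$ consists of mutually orthogonal projections $P_v$ ($v\in E^0$) and partial isometries $S_e$ ($e\in E^1$) in $D$ such that $S_e^*S_e=P_{s(e)}$ for all $e$ and $\sum_{e\in\Lambda}S_eS_e^*\le P_v$ for every $v\in E^0$ and every finite $\Lambda\subset r^{-1}(v)$. A representation of $(E,G,\varphi)$ in $D$ is a family $\{P_v,S_e,U_g: v\in E^0,e\in E^1,g\in G\}$ such that: (1) $\{P_v,S_e\}$ is a Toeplitz $E$-family in $D$; (2) $g\mapsto U_g$ is a unitary representation of $G$ in the multiplier algebra $M(D)$; (3) $U_gP_v=P_{gv}U_g$ and $U_gS_e=S_{ge}U_{\varphi(g,e)}$ for all $g,v,e$; (4) $D$ is generated as a $C^*$-algebra by $\{P_vU_g: v\in E^0,g\in G\}\cup\{S_eU_g: e\in E^1,g\in G\}$. Let $A=C_0(E^0)=c_0(E^0)$, $\alpha_g(a)(v)=a(g^{-1}v)$, $B=A\rtimes_\alpha G$ (full crossed product), with universal covariant homomorphism $(i_A,i_G)$ of $(A,G)$ in $M(B)$. Let $\delta_v\in A$ be the characteristic function of $\{v\}$ and $\delta_{v,g}=i_A(\delta_v)i_G(g)\in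 B$. The $B$-correspondence $Y^\varphi$ is the completion of $C_c(E^1\times G)=\mathrm{span}\{\chi_{e,g}\}$, where $\chi_{e,g}$ is the characteristic function of $\{(e,g)\}$, with operations determined by: $\langle\chi_{e,g},\chi_{e',h}\rangle=0$ if $e\ne e'$ and $\langle\chi_{e,g},\chi_{e,h}\rangle=\delta_{g^{-1}s(e),\,g^{-1}h}$; $\chi_{e,h}\cdot\delta_{v,g}=\chi_{e,hg}$ if $s(e)=hv$ and $0$ otherwise; $\delta_{v,g}\cdot\chi_{e,h}=\chi_{ge,\varphi(g,e)h}$ if $v=r(ge)$ and $0$ otherwise. A Toeplitz representation of $(Y^\varphi,B)$ in a $C^*$-algebra $D$ is a pair $(\psi,\zeta)$ of a linear map $\psi\colon Y^\varphi\to D$ and a $*$-homomorphism $\zeta\colon B\to D$ with $\psi(\xi)^*\psi(\eta)=\zeta(\langle\xi,\eta\rangle)$ and $\zeta(b)\psi(\xi)=\psi(b\cdot\xi)$. The Toeplitz algebra $\mathcal T_{Y^\varphi}$ is the $C^*$-algebra generated by a universal Toeplitz representation, denoted $(t_{Y^\varphi},t_B)$. The homomorphism $t_B\colon B\to\mathcal T_{Y^\varphi}$ is nondegenerate, and $\overline{t_B}\colon M(B)\to M(\mathcal T_{Y^\varphi})$ is its extension to multipliers. $1$ denotes the identity of $G$. *)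

(* Defs.v *)
From HB Require Import structures.
From mathcomp Require Import all_boot all_order all_algebra finmap complex.
From mathcomp Require Import all_classical all_reals all_analysis.

Set Implicit Arguments.
Unset Strict Implicit.
Unset Printing Implicit Defensive.

Import Order.TTheory GRing.Theory Num.Theory.
Import numFieldNormedType.Exports.

Local Open Scope classical_set_scope.
Local Open Scope ring_scope.
Local Open Scope complex_scope.

(* MathComp rings are unital, whereas the algebras here (c_0, crossed products,
   Toeplitz algebras) need not have a unit. *)
HB.mixin Record Lmodule_isStarAlgebra (R : realType) A
    of GRing.Lmodule R[i] A := {
  smul : A -> A -> A;
  star : A -> A;
  smulA : forall a b c : A, smul a (smul b c) = smul (smul a b) c;
  smulDl : forall a b c : A, smul (a + b) c = smul a c + smul b c;
  smulDr : forall a b c : A, smul a (b + c) = smul a b + smul a c;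
  smulZl : forall (k : R[i]) (a b : A), smul (k *: a) b = k *: smul a b;
  smulZr : forall (k : R[i]) (a b : A), smul a (k *: b) = k *: smul a b;
  starK : forall a : A, star (star a) = a;
  starD : forall a b : A, star (a + b) = star a + star b;
  starZ : forall (k : R[i]) (a : A), star (k *: a) = k^* *: star a;
  starM : forall a b : A, star (smul a b) = smul (star b) (star a) }.

#[short(type="starAlgType")]
HB.structure Definition StarAlgebra (R : realType) :=
  {A of Lmodule_isStarAlgebra R A & GRing.Lmodule R[i] A}.

Notation "a ** b" := (smul a b) (at level 40, left associativity) : ring_scope.

HB.mixin Record StarAlgebra_isCStar (R : realType) A
    of StarAlgebra R A & CompleteNormedModule R[i] A := {
  cstar_normM : forall a b : A, `|a ** b| <= `|a| * `|b|;
  cstar_normE : forall a : A, `|star a ** a| = `|a| ^+ 2 }.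

#[short(type="cstarAlgType")]
HB.structure Definition CStarAlgebra (R : realType) :=
  {A of StarAlgebra_isCStar R A & StarAlgebra R A
      & CompleteNormedModule R[i] A}.

Definition is_starhom (R : realType) (A B : starAlgType R) (f : A -> B) : Prop :=
  [/\ linear f, forall a b, f (a ** b) = f a ** f b
    & forall a, f (star a) = star (f a)].

Definition cstar_pos (R : realType) (A : cstarAlgType R) (a : A) : Prop :=
  exists c : A, a = star c ** c.

Definition cstar_le (R : realType) (A : cstarAlgType R) (a b : A) : Prop :=
  cstar_pos (b - a).

Definition lin_span (K : pzRingType) (V : lmodType K) (S : set V) : set V :=
  [set x | exists n (k : 'I_n -> K) (v : 'I_n -> V),
     (forall i, S (v i)) /\ x = \sum_(i < n) k i *: v i].

Definition is_cstar_subalg (R : realType) (A : cstarAlgType R) (S : set A) : Prop :=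
  [/\ S 0, forall (k : R[i]) a b, S a -> S b -> S (k *: a + b),
      forall a b, S a -> S b -> S (a ** b),
      forall a, S a -> S (star a) & closed S].

Definition cstar_generated (R : realType) (A : cstarAlgType R) (S : set A) : set A :=
  smallest (@is_cstar_subalg R A) S.

(* M(D) as the algebra of double centralizers of D: lmult m d is the product
   m d and rmult m d is the product d m.  Linearity and boundedness of both
   maps follow from mult_assoc. *)
Record multiplier (R : realType) (D : cstarAlgType R) := Multiplier {
  lmult : D -> D;
  rmult : D -> D;
  mult_assoc : forall a b : D, a ** lmult b = rmult a ** b }.

Section MultiplierAlgebra.
Variables (R : realType) (D : cstarAlgType R).
Local Notation M := (multiplier D).
Implicit Types (m n p : M) (a b c d : D).

HB.instance Definition _ := gen_eqMixin M.
HB.instance Definition _ := gen_choiceMixin M.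

Lemma multiplier_eq m n :
  (forall d, lmult m d = lmult n d) -> (forall d, rmult m d = rmult n d) -> m = n.
Proof.
case: m n => [l r h] [l' r' h'] /= /funext el /funext er.
by move: h h'; rewrite el er => h h'; rewrite (Prop_irrelevance h h').
Qed.

Lemma star0 : star (0 : D) = 0.
Proof. by apply: (addrI (star (0 : D))); rewrite -starD !addr0. Qed.

Lemma starN a : star (- a) = - star a.
Proof. by apply: (addrI (star a)); rewrite -starD !subrr star0. Qed.

Lemma smulr0 a : a ** 0 = 0.
Proof. by apply: (addrI (a ** 0)); rewrite -smulDr !addr0. Qed.

Lemma smul0r a : 0 ** a = 0.
Proof. by apply: (addrI (0 ** a)); rewrite -smulDl !addr0. Qed.

Lemma smulrN a b : a ** (- b) = - (a ** b).
Proof. by apply: (addrI (a ** b)); rewrite -smulDr !subrr smulr0. Qed.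

Lemma smulNr a b : (- a) ** b = - (a ** b).
Proof. by apply: (addrI (a ** b)); rewrite -smulDl !subrr smul0r. Qed.

Lemma star_smul_eq0 a : star a ** a = 0 -> a = 0.
Proof.
by move=> a0; apply/eqP; rewrite -normr_eq0 -sqrf_eq0 -cstar_normE a0 normr0.
Qed.

Lemma smul_injl a b : (forall c, c ** a = c ** b) -> a = b.
Proof.
move=> ab; apply/eqP; rewrite -subr_eq0; apply/eqP/star_smul_eq0.
by rewrite smulDr smulrN ab subrr.
Qed.

Lemma smul_injr a b : (forall c, a ** c = b ** c) -> a = b.
Proof.
move=> ab; rewrite -[a]starK -[b]starK; congr star.
by apply: smul_injl => c; rewrite -[c]starK -!starM ab.
Qed.

Lemma lmultD m a b : lmult m (a + b) = lmult m a + lmult m b.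
Proof. by apply: smul_injl => c; rewrite mult_assoc !smulDr !mult_assoc. Qed.

Lemma rmultD m a b : rmult m (a + b) = rmult m a + rmult m b.
Proof. by apply: smul_injr => c; rewrite -mult_assoc !smulDl -!mult_assoc. Qed.

Lemma lmultZ m (k : R[i]) a : lmult m (k *: a) = k *: lmult m a.
Proof. by apply: smul_injl => c; rewrite mult_assoc !smulZr !mult_assoc. Qed.

Lemma rmultZ m (k : R[i]) a : rmult m (k *: a) = k *: rmult m a.
Proof. by apply: smul_injr => c; rewrite -mult_assoc !smulZl -!mult_assoc. Qed.

Lemma mult_zero_assoc a b : a ** 0 = 0 ** b.
Proof. by rewrite smulr0 smul0r. Qed.

Definition mult_zero : M :=
  @Multiplier R D (fun d => 0) (fun d => 0) mult_zero_assoc.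

Lemma mult_one_assoc a b : a ** b = a ** b.
Proof. by []. Qed.

Definition mult_one : M :=
  @Multiplier R D (fun d => d) (fun d => d) mult_one_assoc.

Lemma mult_opp_assoc m a b : a ** (- lmult m b) = (- rmult m a) ** b.
Proof. by rewrite smulrN smulNr mult_assoc. Qed.

Definition mult_opp m : M :=
  @Multiplier R D (fun d => - lmult m d) (fun d => - rmult m d)
    (mult_opp_assoc m).

Lemma mult_add_assoc m n a b : a ** (lmult m b + lmult n b) = (rmult m a + rmult n a) ** b.
Proof. by rewrite smulDr smulDl !mult_assoc. Qed.

Definition mult_add m n : M :=
  @Multiplier R D (fun d => lmult m d + lmult n d) (fun d => rmult m d + rmult n d)
    (mult_add_assoc m n).

Lemma mult_scale_assoc (k : R[i]) m a b : a ** (k *: lmult m b) = (k *: rmult m a) ** b.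
Proof. by rewrite smulZr smulZl mult_assoc. Qed.

Definition mult_scale (k : R[i]) m : M :=
  @Multiplier R D (fun d => k *: lmult m d) (fun d => k *: rmult m d)
    (mult_scale_assoc k m).

Lemma mult_mul_assoc m n a b : a ** (lmult m (lmult n b)) = (rmult n (rmult m a)) ** b.
Proof. by rewrite !mult_assoc. Qed.

Definition mult_mul m n : M :=
  @Multiplier R D (fun d => lmult m (lmult n d)) (fun d => rmult n (rmult m d))
    (mult_mul_assoc m n).

Lemma mult_star_assoc m a b : a ** (star (rmult m (star b))) = (star (lmult m (star a))) ** b.
Proof. by rewrite -{1}[a]starK -starM -mult_assoc starM starK. Qed.

Definition mult_star m : M :=
  @Multiplier R D (fun d => star (rmult m (star d))) (fun d => star (lmult m (star d)))
    (mult_star_assoc m).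

Lemma to_mult_assoc c a b : a ** (c ** b) = (a ** c) ** b.
Proof. by rewrite smulA. Qed.

Definition to_mult c : M :=
  @Multiplier R D (fun d => c ** d) (fun d => d ** c)
    (to_mult_assoc c).

Lemma mult_addA : associative mult_add.
Proof. by move=> m n p; apply: multiplier_eq => d /=; rewrite addrA. Qed.

Lemma mult_addC : commutative mult_add.
Proof. by move=> m n; apply: multiplier_eq => d /=; rewrite addrC. Qed.

Lemma mult_add0 : left_id mult_zero mult_add.
Proof. by move=> m; apply: multiplier_eq => d /=; rewrite add0r. Qed.

Lemma mult_addN : left_inverse mult_zero mult_opp mult_add.
Proof. by move=> m; apply: multiplier_eq => d /=; rewrite addNr. Qed.

HB.instance Definition _ :=
  GRing.isZmodule.Build M mult_addA mult_addC mult_add0 mult_addN.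

Lemma mult_scaleA (k l : R[i]) m :
  mult_scale k (mult_scale l m) = mult_scale (k * l) m.
Proof. by apply: multiplier_eq => d /=; rewrite scalerA. Qed.

Lemma mult_scale1 : left_id 1 mult_scale.
Proof. by move=> m; apply: multiplier_eq => d /=; rewrite scale1r. Qed.

Lemma mult_scaleDr : right_distributive mult_scale +%R.
Proof. by move=> k m n; apply: multiplier_eq => d /=; rewrite scalerDr. Qed.

Lemma mult_scaleDl m : {morph mult_scale^~ m : k l / k + l}.
Proof. by move=> k l; apply: multiplier_eq => d /=; rewrite scalerDl. Qed.

HB.instance Definition _ := GRing.Zmodule_isLmodule.Build R[i] M
  mult_scaleA mult_scale1 mult_scaleDr mult_scaleDl.

Lemma mult_mulA m n p : mult_mul m (mult_mul n p) = mult_mul (mult_mul m n) p.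
Proof. by apply: multiplier_eq. Qed.

Lemma mult_mulDl m n p : mult_mul (m + n) p = mult_mul m p + mult_mul n p.
Proof. by apply: multiplier_eq => d //=; rewrite rmultD. Qed.

Lemma mult_mulDr m n p : mult_mul m (n + p) = mult_mul m n + mult_mul m p.
Proof. by apply: multiplier_eq => d //=; rewrite lmultD. Qed.

Lemma mult_mulZl (k : R[i]) m n : mult_mul (k *: m) n = k *: mult_mul m n.
Proof. by apply: multiplier_eq => d //=; rewrite rmultZ. Qed.

Lemma mult_mulZr (k : R[i]) m n : mult_mul m (k *: n) = k *: mult_mul m n.
Proof. by apply: multiplier_eq => d //=; rewrite lmultZ. Qed.

Lemma mult_starK m : mult_star (mult_star m) = m.
Proof. by apply: multiplier_eq => d /=; rewrite !starK. Qed.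

Lemma mult_starD m n : mult_star (m + n) = mult_star m + mult_star n.
Proof. by apply: multiplier_eq => d /=; rewrite starD. Qed.

Lemma mult_starZ (k : R[i]) m : mult_star (k *: m) = k^* *: mult_star m.
Proof. by apply: multiplier_eq => d /=; rewrite starZ. Qed.

Lemma mult_starM m n : mult_star (mult_mul m n) = mult_mul (mult_star n) (mult_star m).
Proof. by apply: multiplier_eq => d /=; rewrite !starK. Qed.

HB.instance Definition _ := Lmodule_isStarAlgebra.Build R M
  mult_mulA mult_mulDl mult_mulDr mult_mulZl mult_mulZr
  mult_starK mult_starD mult_starZ mult_starM.

End MultiplierAlgebra.

Arguments mult_one {R D}.
Arguments to_mult {R D}.

(* The inverse of the inclusion of D in M(D), on multipliers lying in D. *)
Definition mult_elt (R : realType) (D : cstarAlgType R) (m : multiplier D) : D :=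
  xget 0 [set d | to_mult d = m].

Definition nondegenerate (R : realType) (A : Type) (D : cstarAlgType R)
    (f : A -> multiplier D) : Prop :=
  closure (lin_span [set x | exists a d, x = lmult (f a) d]) = setT.

(* For a nondegenerate homomorphism f : A -> M(D), the image of m is the only
   multiplier n of D such that n f(a) = f(m a) for every a in A. *)
Definition mult_ext (R : realType) (A D : cstarAlgType R)
    (f : A -> multiplier D) (m : multiplier A) : multiplier D :=
  xget 0 [set n : multiplier D | forall a, n ** f a = f (lmult m a)].

Definition is_unitary_rep (R : realType) (G : groupType) (D : cstarAlgType R)
    (U : G -> multiplier D) : Prop :=
  [/\ U 1%g = mult_one, forall g h, U (g * h)%g = U g ** U h
    & forall g, star (U g) ** U g = mult_one /\ U g ** star (U g) = mult_one].

(* Only the star-algebra structure of A is used: star-homomorphisms from a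
   C*-algebra into a C*-algebra (such as M(D)) are automatically contractive. *)
Definition is_covariant (R : realType) (G : groupType) (A : starAlgType R)
    (alpha : G -> A -> A) (D : cstarAlgType R)
    (pi : A -> multiplier D) (U : G -> multiplier D) : Prop :=
  [/\ is_starhom pi, nondegenerate pi, is_unitary_rep U
    & forall g a, pi (alpha g a) = U g ** pi a ** star (U g)].

Definition is_crossed_product (R : realType) (G : groupType) (A : starAlgType R)
    (alpha : G -> A -> A) (B : cstarAlgType R)
    (iA : A -> multiplier B) (iG : G -> multiplier B) : Prop :=
  [/\ is_covariant alpha iA iG,
      forall a g, exists b : B, to_mult b = iA a ** iG g,
      closure (lin_span [set b : B | exists a g, to_mult b = iA a ** iG g]) = setT
    & forall (C : cstarAlgType R) (pi : A -> multiplier C) (U : G -> multiplier C),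
        is_covariant alpha pi U ->
        exists L : B -> multiplier C,
          [/\ is_starhom L, nondegenerate L, forall a, mult_ext L (iA a) = pi a
            & forall g, mult_ext L (iG g) = U g]].

Definition vanishes_at_infinity (R : realType) (X : choiceType) (f : X -> R[i]) : Prop :=
  forall e : R[i], 0 < e -> finite_set [set x | e <= `|f x|].

Record c0 (R : realType) (X : choiceType) := C0 {
  c0_fun :> X -> R[i];
  c0P : vanishes_at_infinity c0_fun }.

Section C0Algebra.
Variables (R : realType) (X : choiceType).
Local Notation A := (c0 R X).
Implicit Types f g h : A.

HB.instance Definition _ := gen_eqMixin A.
HB.instance Definition _ := gen_choiceMixin A.

Lemma c0_eq f g : (forall x, f x = g x) -> f = g.
Proof.
case: f g => [f hf] [g hg] /= /funext fg.
by move: hf hg; rewrite fg => hf hg; rewrite (Prop_irrelevance hf hg).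
Qed.

Lemma vanishes_zero : vanishes_at_infinity (fun _ : X => 0 : R[i]).
Proof.
move=> e e0; apply: (@sub_finite_set _ _ set0) => // x /=.
by rewrite normr0 => /(lt_le_trans e0); rewrite ltxx.
Qed.

Lemma vanishes_opp f : vanishes_at_infinity (fun x => - f x).
Proof.
by move=> e e0; apply: sub_finite_set (c0P f e0) => x /=; rewrite normrN.
Qed.

Lemma vanishes_add f g : vanishes_at_infinity (fun x => f x + g x).
Proof.
move=> e e0; have e20 : 0 < e / 2 by rewrite divr_gt0.
have fin : finite_set ([set x | e / 2 <= `|f x|] `|` [set x | e / 2 <= `|g x|]).
  by rewrite finite_setU; split; exact: c0P.
apply: sub_finite_set fin => x /= lex.
have re : e / 2 \is Num.real by exact: gtr0_real.
case: (real_leP re (normr_real (f x))) => [|fx]; first by left.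
case: (real_leP re (normr_real (g x))) => [|gx]; first by right.
have := le_lt_trans (ler_normD (f x) (g x)) (ltrD fx gx).
by rewrite -splitr => /(le_lt_trans lex); rewrite ltxx.
Qed.

Lemma vanishes_mul f g : vanishes_at_infinity (fun x => f x * g x).
Proof.
move=> e e0.
have fin : finite_set ([set x | 1 <= `|f x|] `|` [set x | e <= `|g x|]).
  by rewrite finite_setU; split; exact: c0P.
apply: sub_finite_set fin => x /= lex.
case: (real_leP (@real1 R[i]) (normr_real (f x))) => [|fx]; first by left.
case: (real_leP (gtr0_real e0) (normr_real (g x))) => [|gx]; first by right.
suff : `|f x * g x| < e by move=> /(le_lt_trans lex); rewrite ltxx.
by rewrite normrM -[e]mul1r ltr_pM.
Qed.

Lemma vanishes_scale (k : R[i]) f : vanishes_at_infinity (fun x => k * f x).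
Proof.
move=> e e0; have k0 : 0 < `|k| + 1 by rewrite ltr_wpDl.
have ek0 : 0 < e / (`|k| + 1) by rewrite divr_gt0.
apply: sub_finite_set (c0P f ek0) => x /= lex.
rewrite ler_pdivrMr //; apply: (le_trans lex).
by rewrite normrM mulrC ler_wpM2l // lerDl.
Qed.

Lemma vanishes_conj f : vanishes_at_infinity (fun x => (f x)^*).
Proof.
move=> e e0; apply: sub_finite_set (c0P f e0) => x /=.
by rewrite !normc_def /=; case: (f x) => a b /=; rewrite sqrrN.
Qed.

Lemma vanishes_indic (v : X) : vanishes_at_infinity (fun x => (x == v)%:R : R[i]).
Proof.
move=> e e0; apply: (@sub_finite_set _ _ [set v]); last exact: finite_set1.
move=> x /=; case: eqP => // _; rewrite normr0 => /(lt_le_trans e0).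
by rewrite ltxx.
Qed.

Definition c0_zero : A := C0 vanishes_zero.
Definition c0_opp f : A := C0 (vanishes_opp f).
Definition c0_add f g : A := C0 (vanishes_add f g).
Definition c0_mul f g : A := C0 (vanishes_mul f g).
Definition c0_scale (k : R[i]) f : A := C0 (vanishes_scale k f).
Definition c0_star f : A := C0 (vanishes_conj f).

Definition c0_delta (v : X) : A := C0 (vanishes_indic v).

Lemma c0_addA : associative c0_add.
Proof. by move=> f g h; apply: c0_eq => x /=; rewrite addrA. Qed.

Lemma c0_addC : commutative c0_add.
Proof. by move=> f g; apply: c0_eq => x /=; rewrite addrC. Qed.

Lemma c0_add0 : left_id c0_zero c0_add.
Proof. by move=> f; apply: c0_eq => x /=; rewrite add0r. Qed.

Lemma c0_addN : left_inverse c0_zero c0_opp c0_add.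
Proof. by move=> f; apply: c0_eq => x /=; rewrite addNr. Qed.

HB.instance Definition _ :=
  GRing.isZmodule.Build A c0_addA c0_addC c0_add0 c0_addN.

Lemma c0_scaleA (k l : R[i]) f : c0_scale k (c0_scale l f) = c0_scale (k * l) f.
Proof. by apply: c0_eq => x /=; rewrite mulrA. Qed.

Lemma c0_scale1 : left_id 1 c0_scale.
Proof. by move=> f; apply: c0_eq => x /=; rewrite mul1r. Qed.

Lemma c0_scaleDr : right_distributive c0_scale +%R.
Proof. by move=> k f g; apply: c0_eq => x /=; rewrite mulrDr. Qed.

Lemma c0_scaleDl f : {morph c0_scale^~ f : k l / k + l}.
Proof. by move=> k l; apply: c0_eq => x /=; rewrite mulrDl. Qed.

HB.instance Definition _ := GRing.Zmodule_isLmodule.Build R[i] A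
  c0_scaleA c0_scale1 c0_scaleDr c0_scaleDl.

Lemma c0_mulA f g h : c0_mul f (c0_mul g h) = c0_mul (c0_mul f g) h.
Proof. by apply: c0_eq => x /=; rewrite mulrA. Qed.

Lemma c0_mulDl f g h : c0_mul (f + g) h = c0_mul f h + c0_mul g h.
Proof. by apply: c0_eq => x /=; rewrite mulrDl. Qed.

Lemma c0_mulDr f g h : c0_mul f (g + h) = c0_mul f g + c0_mul f h.
Proof. by apply: c0_eq => x /=; rewrite mulrDr. Qed.

Lemma c0_mulZl (k : R[i]) f g : c0_mul (k *: f) g = k *: c0_mul f g.
Proof. by apply: c0_eq => x /=; rewrite mulrA. Qed.

Lemma c0_mulZr (k : R[i]) f g : c0_mul f (k *: g) = k *: c0_mul f g.
Proof. by apply: c0_eq => x /=; rewrite mulrCA. Qed.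

Lemma c0_starK f : c0_star (c0_star f) = f.
Proof. by apply: c0_eq => x /=; rewrite conjcK. Qed.

Lemma c0_starD f g : c0_star (f + g) = c0_star f + c0_star g.
Proof. by apply: c0_eq => x /=; rewrite rmorphD. Qed.

Lemma c0_starZ (k : R[i]) f : c0_star (k *: f) = k^* *: c0_star f.
Proof. by apply: c0_eq => x /=; rewrite rmorphM. Qed.

Lemma c0_starM f g : c0_star (c0_mul f g) = c0_mul (c0_star g) (c0_star f).
Proof. by apply: c0_eq => x /=; rewrite rmorphM mulrC. Qed.

HB.instance Definition _ := Lmodule_isStarAlgebra.Build R A
  c0_mulA c0_mulDl c0_mulDr c0_mulZl c0_mulZr
  c0_starK c0_starD c0_starZ c0_starM.

End C0Algebra.

Record digraph := Digraph {
  vertex : choiceType;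
  edge : choiceType;
  rng : edge -> vertex;
  src : edge -> vertex }.

Record graph_action (G : groupType) (E : digraph) := GraphAction {
  actv : G -> vertex E -> vertex E;
  acte : G -> edge E -> edge E;
  actv1 : forall v, actv 1%g v = v;
  actvM : forall g h v, actv (g * h)%g v = actv g (actv h v);
  acte1 : forall e, acte 1%g e = e;
  acteM : forall g h e, acte (g * h)%g e = acte g (acte h e);
  rng_act : forall g e, rng (acte g e) = actv g (rng e);
  src_act : forall g e, src (acte g e) = actv g (src e) }.

Definition is_cocycle (G : groupType) (E : digraph) (act : graph_action G E)
    (phi : G -> edge E -> G) : Prop :=
  (forall g h e, phi (g * h)%g e = (phi g (acte act h e) * phi h e)%g) /\
  (forall g e, actv act (phi g e) (src e) = actv act g (src e)).

Lemma vanishes_act (R : realType) (G : groupType) (E : digraph)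
    (act : graph_action G E) (g : G) (a : c0 R (vertex E)) :
  vanishes_at_infinity (fun v => a (actv act g^-1%g v)).
Proof.
move=> e e0; apply: sub_finite_set (finite_image (actv act g) (c0P a e0)).
move=> v /= lev; exists (actv act g^-1%g v) => //.
by rewrite -actvM divgg actv1.
Qed.

Definition c0_act (R : realType) (G : groupType) (E : digraph)
    (act : graph_action G E) (g : G) (a : c0 R (vertex E)) : c0 R (vertex E) :=
  C0 (vanishes_act act g a).

Definition is_toeplitz_family (R : realType) (E : digraph) (D : cstarAlgType R)
    (P : vertex E -> D) (S : edge E -> D) : Prop :=
  [/\ forall v, star (P v) = P v /\ P v ** P v = P v,
      forall v w, v <> w -> P v ** P w = 0,
      forall e, S e ** star (S e) ** S e = S e,
      forall e, star (S e) ** S e = P (src e)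
    & forall v (L : {fset edge E}), (forall e, e \in L -> rng e = v) ->
        cstar_le (\sum_(e <- L) S e ** star (S e)) (P v)].

Definition is_representation (R : realType) (G : groupType) (E : digraph)
    (act : graph_action G E) (phi : G -> edge E -> G) (D : cstarAlgType R)
    (P : vertex E -> D) (S : edge E -> D) (U : G -> multiplier D) : Prop :=
  [/\ is_toeplitz_family P S,
      is_unitary_rep U,
      forall g v, lmult (U g) (P v) = rmult (U g) (P (actv act g v)),
      forall g e, lmult (U g) (S e) = rmult (U (phi g e)) (S (acte act g e))
    & cstar_generated ([set d | exists v g, d = rmult (U g) (P v)] `|`
                       [set d | exists e g, d = rmult (U g) (S e)]) = setT].

(* Right Hilbert B-modules with a left action of B by adjointable operators. *)
Record correspondence (R : realType) (B : cstarAlgType R) := Correspondence {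
  corr_module :> completeNormedModType R[i];
  ract : corr_module -> B -> corr_module;
  lact : B -> corr_module -> corr_module;
  ip : corr_module -> corr_module -> B;
  ract_linearl : forall b, linear (ract^~ b);
  ract_linearr : forall x, linear (ract x);
  ractM : forall x a b, ract x (a ** b) = ract (ract x a) b;
  ip_linear : forall x, linear (ip x);
  ip_star : forall x y, star (ip x y) = ip y x;
  ip_ract : forall x y b, ip x (ract y b) = ip x y ** b;
  ip_pos : forall x, cstar_pos (ip x x);
  corr_norm : forall x, `|x| ^+ 2 = `|ip x x|;
  lact_linearl : forall x, linear (lact^~ x);
  lact_linearr : forall b, linear (lact b);
  lactM : forall a b x, lact (a ** b) x = lact a (lact b x);
  lact_adj : forall b x y, ip (lact b x) y = ip x (lact (star b) y) }.

Definition is_toeplitz_rep (R : realType) (B : cstarAlgType R)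
    (Y : correspondence B) (D : cstarAlgType R) (psi : Y -> D) (zeta : B -> D) : Prop :=
  [/\ linear psi, is_starhom zeta,
      forall x y, star (psi x) ** psi y = zeta (ip x y)
    & forall b x, zeta b ** psi x = psi (lact b x)].

Definition is_toeplitz_algebra (R : realType) (B : cstarAlgType R)
    (Y : correspondence B) (T : cstarAlgType R) (tY : Y -> T) (tB : B -> T) : Prop :=
  [/\ is_toeplitz_rep tY tB,
      cstar_generated (range tY `|` range tB) = setT
    & forall (C : cstarAlgType R) (psi : Y -> C) (zeta : B -> C),
        is_toeplitz_rep psi zeta ->
        exists h : T -> C,
          [/\ is_starhom h, forall x, h (tY x) = psi x & forall b, h (tB b) = zeta b]].

(* The multiplier i_A(delta_v) i_G(g) lies in B because G is discrete. *)
Definition delta (R : realType) (G : groupType) (E : digraph) (B : cstarAlgType R)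
    (iA : c0 R (vertex E) -> multiplier B) (iG : G -> multiplier B)
    (v : vertex E) (g : G) : B :=
  mult_elt (iA (c0_delta R v) ** iG g).

(* chi e g is the image in Y of the characteristic function of {(e, g)}; the
   density condition says that Y is the completion of C_c(E^1 x G). *)
Definition is_graph_correspondence (R : realType) (G : groupType) (E : digraph)
    (act : graph_action G E) (phi : G -> edge E -> G) (B : cstarAlgType R)
    (iA : c0 R (vertex E) -> multiplier B) (iG : G -> multiplier B)
    (Y : correspondence B) (chi : edge E -> G -> Y) : Prop :=
  let d := delta iA iG in
  [/\ closure (lin_span [set y : Y | exists e g, y = chi e g]) = setT,
      forall e e' g h, ip (chi e g) (chi e' h) =
        if e == e' then d (actv act g^-1%g (src e)) (g^-1 * h)%g else 0,
      forall e h v g, ract (chi e h) (d v g) =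
        if src e == actv act h v then chi e (h * g)%g else 0
    & forall v g e h, lact (d v g) (chi e h) =
        if v == rng (acte act g e) then chi (acte act g e) (phi g e * h)%g else 0].

(* Main.v *)
Require Import Defs.
From mathcomp Require Import all_boot all_order all_algebra finmap complex.
From mathcomp Require Import all_classical all_reals all_analysis.
From mathcomp Require Import ring lra.

Set Implicit Arguments.
Unset Strict Implicit.
Unset Printing Implicit Defensive.

Import Order.TTheory GRing.Theory Num.Theory.
Import numFieldNormedType.Exports.

Local Open Scope classical_set_scope.
Local Open Scope ring_scope.
Local Open Scope complex_scope.

(** The homomorphism exists by two universal properties.  Summing the
projections gives pi : c_0(E^0) -> D with pi(delta_v) = P_v, and (pi, U) is covariant,
so it integrates to zeta : B -> D with zeta(i_A(a) i_G(g)) = pi(a) U_g.  The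
assignment chi_{e,g} |-> S_e U_g extends to psi : Y -> D, because
(S_e U_g)* (S_f U_h) = zeta(<chi_{e,g}, chi_{f,h}>), and (psi, zeta) is a Toeplitz
representation; Phi is the homomorphism that it induces on T.  The range of Phi
contains the generators of D.  Finally u_g t_B(b) = t_B(i_G(g) b), so Phi intertwines u_g
and U_g, and the family p_v, s_e, u_g determines a homomorphism on T.  The
corresponding lemmas are covariant_representation, integrated_form, psi_exists,
intertwine and target_unique.

These steps rest on three facts about C*-algebras, proved here without
spectral theory.

Algebraic *-homomorphisms are bounded (star_rep_bounded).  If a = a* and |a| <= 1
then sqrt(1 - a^2) exists as the limit of an explicit iteration (mult_sqrt), and
a + i sqrt(1 - a^2) is unitary, so its image is isometric and has the image of a as
its self-adjoint part (nrm_orth_part).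

A sum of hermitian squares vanishes only termwise (sum_squares_eq0).  This turns the
inequality between the sum of the S_e S_e* and P_v into the relations
P_{r(e)} S_e = S_e and S_e* S_f = 0 for e <> f (proj_rng, isom_orth).

A *-homomorphism with dense range is onto (dense_range_onto).  The transform
t |-> t/(1 + t^2) produces lifts of bounded norm, and a geometric series of
corrections makes them exact.

The multiplier u_g needs separate care: it is the extension of t_B evaluated at
i_G(g), whose existence is shown by unitary_extension for unitary multipliers, from
the nondegeneracy of t_B (toeplitz_nondegenerate). *)

(** * Real-valued norms, limits and closures *)

(** Norms take values in R[i]; their real parts carry the same information in
the ordered field R, where inequalities between them can be manipulated. *)
Definition nrm (R : realType) (V : normedZmodType R[i]) (x : V) : R :=
  complex.Re `|x|.

Section Norm.
Variable R : realType.

Lemma normE (V : normedZmodType R[i]) (x : V) : `|x| = (nrm x)%:C.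
Proof. by rewrite /nrm RRe_real. Qed.

Lemma nrm_ge0 (V : normedZmodType R[i]) (x : V) : 0 <= nrm x.
Proof. by rewrite -ler0c -normE. Qed.

Lemma nrmD (V : normedZmodType R[i]) (x y : V) : nrm (x + y) <= nrm x + nrm y.
Proof. by rewrite -lecR rmorphD /= -!normE ler_normD. Qed.

Lemma nrmN (V : normedZmodType R[i]) (x : V) : nrm (- x) = nrm x.
Proof. by rewrite /nrm normrN. Qed.

Lemma nrmB (V : normedZmodType R[i]) (x y : V) : nrm (x - y) <= nrm x + nrm y.
Proof. by rewrite -(nrmN y) nrmD. Qed.

Lemma nrm_distC (V : normedZmodType R[i]) (x y : V) : nrm (x - y) = nrm (y - x).
Proof. by rewrite -nrmN opprB. Qed.

Lemma nrm_tri (V : normedZmodType R[i]) (y x z : V) :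
  nrm (x - z) <= nrm (x - y) + nrm (y - z).
Proof. by rewrite -[x - z](subrKA y) nrmD. Qed.

Lemma nrm0 (V : normedZmodType R[i]) : nrm (0 : V) = 0.
Proof. by rewrite /nrm normr0. Qed.

Lemma nrm_eq0 (V : normedZmodType R[i]) (x : V) : (nrm x == 0) = (x == 0).
Proof. by rewrite -[RHS]normr_eq0 normE (inj_eq (@complexI R)). Qed.

Lemma nrm_gt0 (V : normedZmodType R[i]) (x : V) : (0 < nrm x) = (x != 0).
Proof. by rewrite lt_def nrm_ge0 andbT nrm_eq0. Qed.

Lemma nrmZ (V : normedModType R[i]) (k : R[i]) (x : V) :
  nrm (k *: x) = nrm k * nrm x.
Proof. by apply: (@complexI R); rewrite rmorphM /= -!normE normrZ. Qed.

Lemma nrmC (r : R) : nrm r%:C = `|r|.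
Proof. by rewrite /nrm normc_def /= expr0n addr0 sqrtr_sqr. Qed.

Lemma nrm_i : nrm 'i%C = 1 :> R.
Proof. by rewrite /nrm normc_def /= expr0n expr1n add0r sqrtr1. Qed.

Lemma nrmCM (k l : R[i]) : nrm (k * l) = nrm k * nrm l.
Proof. by apply: (@complexI R); rewrite rmorphM /= -!normE normrM. Qed.

Lemma nrmZr (V : normedModType R[i]) (r : R) (x : V) : 0 <= r ->
  nrm (r%:C *: x) = r * nrm x.
Proof. by move=> r0; rewrite nrmZ nrmC ger0_norm. Qed.

Lemma nrm_conj (k : R[i]) : nrm (k^*)%C = nrm k.
Proof. by rewrite /nrm normcJ. Qed.

Lemma le_eps0 (x : R) : (forall e, 0 < e -> x <= e) -> x <= 0.
Proof. by move=> h; apply/ler_addgt0Pr => e /h; rewrite add0r. Qed.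

Lemma nrm_eps0 (V : normedZmodType R[i]) (x : V) :
  (forall e : R, 0 < e -> nrm x <= e) -> x = 0.
Proof.
move=> /le_eps0 h; apply/eqP; rewrite -nrm_eq0; apply/eqP/le_anti.
by rewrite h nrm_ge0.
Qed.

Lemma closure_nrmP (V : normedModType R[i]) (A : set V) (x : V) :
  closure A x <-> forall e : R, 0 < e -> exists2 y, A y & nrm (x - y) <= e.
Proof.
split=> [cAx e e0|h B /nbhs_ballP[e /= e0 eB]].
  have /cAx[y [Ay By]] : nbhs x (ball x e%:C).
    by apply: nbhsx_ballx; rewrite ltcR.
  exists y => //; move: By; rewrite -ball_normE /= normE ltcR; exact: ltW.
have er : e = (complex.Re e)%:C by rewrite RRe_real ?gtr0_real.
have e0' : 0 < complex.Re e / 2.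
  by rewrite divr_gt0 // -ltcR -er.
have [y Ay xy] := h _ e0'; exists y; split=> //; apply: eB.
rewrite -ball_normE /= normE er ltcR; apply: le_lt_trans xy _.
by rewrite gtr_pMr ?invf_lt1 ?ltr1n //; move: e0'; rewrite pmulr_lgt0.
Qed.

Lemma nrm_complete (V : completeNormedModType R[i]) (u : nat -> V) :
  (forall e : R, 0 < e -> exists N, forall n m, (N <= n)%N -> (N <= m)%N ->
     nrm (u n - u m) <= e) ->
  exists l, forall e : R, 0 < e ->
    exists N, forall n, (N <= n)%N -> nrm (l - u n) <= e.
Proof.
move=> h.
have re (e : R[i]) : 0 < e -> 0 < complex.Re e /\ e = (complex.Re e)%:C.
  move=> e0; have er : e = (complex.Re e)%:C by rewrite RRe_real ?gtr0_real.
  by rewrite -ltcR -er.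
have /cvg_ex[l ul] : cvg (u @ \oo).
  apply/cauchy_cvgP/cauchy_exP => e e0.
  have [r0 ->] := re _ e0.
  have r20 : 0 < complex.Re e / 2 by rewrite divr_gt0.
  have [N hN] := h _ r20.
  exists (u N); exists N => // n /= Nn.
  rewrite -ball_normE /= normE ltcR; apply: le_lt_trans (hN _ _ (leqnn N) Nn) _.
  by lra.
exists l => e e0.
move/cvgrPdist_le: ul => /(_ e%:C); rewrite ltcR => /(_ e0)[N _ hN].
by exists N => n /hN; rewrite normE lecR.
Qed.

Lemma telescope_le (V : normedZmodType R[i]) (u : nat -> V) (c : nat -> R) n k :
  (forall n, nrm (u n.+1 - u n) <= c n.+1 - c n) ->
  nrm (u (n + k)%N - u n) <= c (n + k)%N - c n.
Proof.
move=> h; elim: k => [|k IH]; first by rewrite addn0 !subrr nrm0.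
rewrite addnS; have := nrm_tri (u (n + k)%N) (u (n + k).+1) (u n).
by have := h (n + k)%N; move: IH; lra.
Qed.

Lemma bounded_incr_cauchy (c : nat -> R) (M : R) :
  (forall n, c n <= c n.+1) -> (forall n, c n <= M) ->
  forall e, 0 < e -> exists N, forall n, (N <= n)%N -> c n - c N <= e.
Proof.
move=> ci cM e e0.
have sc : has_sup (range c).
  split; first by exists (c 0%N), 0%N.
  by exists M => _ [n _ <-].
have [_ [N _ <-] cN] := sup_adherent e0 sc.
exists N => n _; have : c n <= sup (range c).
  by apply: ub_le_sup; [exact: sc.2 | exists n].
by move: cN; lra.
Qed.

Lemma incr_le (c : nat -> R) n k : (forall n, c n <= c n.+1) -> c n <= c (n + k)%N.
Proof.
by move=> ci; elim: k => [|k IH]; rewrite ?addn0 // addnS (le_trans IH).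
Qed.

(** The form in which completeness serves every iteration below: the increments
of [u] telescope under a bounded real sequence. *)
Lemma dominated_complete (V : completeNormedModType R[i]) (u : nat -> V)
    (c : nat -> R) (M : R) :
  (forall n, nrm (u n.+1 - u n) <= c n.+1 - c n) -> (forall n, c n <= M) ->
  exists l, forall e : R, 0 < e ->
    exists N, forall n, (N <= n)%N -> nrm (l - u n) <= e.
Proof.
move=> uc cM; apply: nrm_complete => e e0.
have ci n : c n <= c n.+1.
  by rewrite -subr_ge0; apply: le_trans (uc n); exact: nrm_ge0.
have e20 : 0 < e / 2 by rewrite divr_gt0.
have [N hN] := bounded_incr_cauchy ci cM e20.
have key n : (N <= n)%N -> nrm (u n - u N) <= e / 2.
  move=> Nn; have := @telescope_le _ u c N (n - N) uc.
  by rewrite subnKC // => /le_trans; apply; apply: hN.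
exists N => n m Nn Nm; have := nrm_tri (u N) (u n) (u m).
by rewrite (nrm_distC (u N)); have := key _ Nn; have := key _ Nm; lra.
Qed.

End Norm.

(** * Norms in C*-algebras and bounds for multipliers *)

Section StarAlgebraTheory.
Variables (R : realType) (A : starAlgType R).
Implicit Types (a b c : A).

Lemma muls0 a : a ** 0 = 0.
Proof. by apply: (addrI (a ** 0)); rewrite -smulDr !addr0. Qed.

Lemma mul0s a : 0 ** a = 0.
Proof. by apply: (addrI (0 ** a)); rewrite -smulDl !addr0. Qed.

Lemma mulsN a b : a ** (- b) = - (a ** b).
Proof. by rewrite -scaleN1r smulZr scaleN1r. Qed.

Lemma mulNs a b : (- a) ** b = - (a ** b).
Proof. by rewrite -scaleN1r smulZl scaleN1r. Qed.

Lemma stars0 : star (0 : A) = 0.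
Proof. by apply: (addrI (star (0 : A))); rewrite -starD !addr0. Qed.

Lemma starsN a : star (- a) = - star a.
Proof. by apply: (addrI (star a)); rewrite -starD !subrr stars0. Qed.

Lemma smulBl a b c : (a - b) ** c = a ** c - b ** c.
Proof. by rewrite smulDl mulNs. Qed.

Lemma smulBr a b c : a ** (b - c) = a ** b - a ** c.
Proof. by rewrite smulDr mulsN. Qed.

Lemma starB a b : star (a - b) = star a - star b.
Proof. by rewrite starD starsN. Qed.

Lemma starZc (k : R[i]) a : star (k *: a) = conjc k *: star a.
Proof. exact: starZ. Qed.

Lemma starZr (r : R) a : star (r%:C *: a) = r%:C *: star a.
Proof. by rewrite starZc conjc_real. Qed.

End StarAlgebraTheory.

Section CStarBasics.
Variables (R : realType) (D : cstarAlgType R).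
Implicit Types (a b c d : D) (m : multiplier D).

Lemma nrmM a b : nrm (a ** b) <= nrm a * nrm b.
Proof. by rewrite -lecR rmorphM /= -!normE cstar_normM. Qed.

Lemma nrm_cstar a : nrm (star a ** a) = nrm a ^+ 2.
Proof. by apply: (@complexI R); rewrite rmorphXn /= -!normE cstar_normE. Qed.

Lemma nrm_star_le a : nrm a <= nrm (star a).
Proof.
have [->|a0] := eqVneq a 0; first by rewrite nrm0 nrm_ge0.
rewrite -nrm_gt0 in a0; rewrite -(ler_pM2r a0) -expr2 -nrm_cstar; exact: nrmM.
Qed.

Lemma nrm_star a : nrm (star a) = nrm a.
Proof. by apply: le_anti; rewrite -{2}[a]starK !nrm_star_le. Qed.

Lemma multiplier_eql (m n : multiplier D) : (forall d, lmult m d = lmult n d) -> m = n.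
Proof.
move=> mn; apply: multiplier_eq => // d.
by apply: smul_injr => c; rewrite -!mult_assoc mn.
Qed.

Lemma lmultDl (m n : multiplier D) d : lmult (m + n) d = lmult m d + lmult n d. Proof. by []. Qed.
Lemma lmultNl m d : lmult (- m) d = - lmult m d. Proof. by []. Qed.
Lemma lmultBl (m n : multiplier D) d : lmult (m - n) d = lmult m d - lmult n d. Proof. by []. Qed.
Lemma lmultZl k m d : lmult (k *: m) d = k *: lmult m d. Proof. by []. Qed.
Lemma lmultMl (m n : multiplier D) d : lmult (m ** n) d = lmult m (lmult n d). Proof. by []. Qed.
Lemma lmult0l d : lmult (0 : multiplier D) d = 0. Proof. by []. Qed.

Lemma lmultN m d : lmult m (- d) = - lmult m d.
Proof. by rewrite -scaleN1r lmultZ scaleN1r. Qed.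

Lemma lmultB m d e : lmult m (d - e) = lmult m d - lmult m e.
Proof. by rewrite lmultD lmultN. Qed.

Lemma lmult_smul m a b : lmult m (a ** b) = lmult m a ** b.
Proof. by apply: smul_injl => c; rewrite mult_assoc !smulA mult_assoc. Qed.

Lemma lmult_adj m a b : star (lmult m a) ** b = star a ** lmult (star m) b.
Proof. by rewrite /= -starM -mult_assoc starM starK. Qed.

Lemma to_multM a b : to_mult (a ** b) = to_mult a ** to_mult b :> multiplier D.
Proof. by apply: multiplier_eql => d /=; rewrite smulA. Qed.

Lemma to_multD a b : to_mult (a + b) = to_mult a + to_mult b :> multiplier D.
Proof. by apply: multiplier_eql => d /=; rewrite smulDl. Qed.

Lemma to_multN a : to_mult (- a) = - to_mult a :> multiplier D.
Proof. by apply: multiplier_eql => d /=; rewrite smulNr. Qed.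

Lemma to_multZ k a : to_mult (k *: a) = k *: to_mult a :> multiplier D.
Proof. by apply: multiplier_eql => d /=; rewrite smulZl. Qed.

Lemma to_mult_star a : to_mult (star a) = star (to_mult a) :> multiplier D.
Proof. by apply: multiplier_eql => d /=; rewrite starM starK. Qed.

Lemma to_mult0 : to_mult (0 : D) = 0 :> multiplier D.
Proof. by apply: multiplier_eql => d /=; rewrite smul0r. Qed.

Lemma to_mult_inj : injective (@to_mult R D).
Proof.
by move=> a b ab; apply: smul_injr => c; have := congr1 (fun m => lmult m c) ab.
Qed.

Lemma mult_eltK m a : to_mult a = m -> mult_elt m = a.
Proof.
move=> am; apply: to_mult_inj; rewrite /mult_elt am.
by apply: (@xgetPex _ 0 [set d | to_mult d = m]); exists a.
Qed.

Lemma lmult_to_mult m a : m ** to_mult a = to_mult (lmult m a).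
Proof. by apply: multiplier_eql => d; rewrite lmultMl /= lmult_smul. Qed.

Lemma rmult_to_mult m a : to_mult a ** m = to_mult (rmult m a).
Proof. by apply: multiplier_eql => d /=; rewrite mult_assoc. Qed.

(** The operator norm of [m] is at most [r].  A relation suffices: elements of
M(D) are only ever compared with explicit bounds, so M(D) itself is never
normed. *)
Definition opb m (r : R) := 0 <= r /\ forall d, nrm (lmult m d) <= r * nrm d.

Lemma opb_le m r s : opb m r -> r <= s -> opb m s.
Proof.
move=> [r0 h] rs; split; first exact: le_trans rs.
by move=> d; apply: le_trans (h d) _; rewrite ler_wpM2r ?nrm_ge0.
Qed.

Lemma opbD (m n : multiplier D) r s : opb m r -> opb n s -> opb (m + n) (r + s).
Proof.
move=> [r0 hm] [s0 hn]; split=> [|d]; first exact: addr_ge0.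
by rewrite mulrDl lmultDl (le_trans (nrmD _ _)) // lerD.
Qed.

Lemma opbN m r : opb m r -> opb (- m) r.
Proof. by move=> [r0 h]; split=> // d; rewrite lmultNl nrmN. Qed.

Lemma opbB (m n : multiplier D) r s : opb m r -> opb n s -> opb (m - n) (r + s).
Proof. by move=> hm /opbN; exact: opbD. Qed.

Lemma opbM (m n : multiplier D) r s : opb m r -> opb n s -> opb (m ** n) (r * s).
Proof.
move=> [r0 hm] [s0 hn]; split=> [|d]; first exact: mulr_ge0.
by rewrite lmultMl (le_trans (hm _)) // -mulrA ler_wpM2l.
Qed.

Lemma opbZ k m r : opb m r -> opb (k *: m) (nrm k * r).
Proof.
move=> [r0 h]; split=> [|d]; first by rewrite mulr_ge0 ?nrm_ge0.
by rewrite lmultZl nrmZ -mulrA ler_wpM2l ?nrm_ge0.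
Qed.

Lemma opbZr (t : R) m r : 0 <= t -> opb m r -> opb (t%:C *: m) (t * r).
Proof. by move=> t0 /(opbZ t%:C); rewrite nrmC ger0_norm. Qed.

Lemma opb1 : opb (mult_one : multiplier D) 1.
Proof. by split=> // d; rewrite mul1r. Qed.

Lemma opb0 : opb (0 : multiplier D) 0.
Proof. by split=> // d; rewrite mul0r nrm0. Qed.

Lemma opb_to_mult a : opb (to_mult a) (nrm a).
Proof. by split=> [|d]; [exact: nrm_ge0 | exact: nrmM]. Qed.

Lemma nrm_opb a r : opb (to_mult a) r -> nrm a <= r.
Proof.
move=> [r0 /(_ (star a)) /=]; rewrite -{1}[a]starK nrm_cstar nrm_star.
have [->|a0] := eqVneq a 0; first by rewrite nrm0.
by rewrite expr2 ler_pM2r // nrm_gt0.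
Qed.

Lemma opb_star m r : opb m r -> opb (star m) r.
Proof.
move=> [r0 h]; split=> // d; set e := lmult _ _.
have [->|e0] := eqVneq e 0; first by rewrite nrm0 mulr_ge0 ?nrm_ge0.
rewrite -nrm_gt0 in e0; rewrite -(ler_pM2r e0) -expr2 -nrm_cstar {1}/e.
rewrite lmult_adj starK (le_trans (nrmM _ _)) // nrm_star.
by rewrite [r * _]mulrC -mulrA ler_wpM2l ?nrm_ge0 // mulrC h.
Qed.

Lemma opb_cstar m r : 0 <= r -> opb (star m ** m) (r ^+ 2) -> opb m r.
Proof.
move=> r0 [_ h]; split=> // d.
rewrite -(@ler_pXn2r _ 2) ?nnegrE ?nrm_ge0 // ?mulr_ge0 ?nrm_ge0 //.
rewrite -nrm_cstar lmult_adj (le_trans (nrmM _ _)) // nrm_star.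
by rewrite exprMn mulrC expr2 mulrA ler_wpM2r ?nrm_ge0 // h.
Qed.

Lemma opb_eps0 m : (forall e, 0 < e -> opb m e) -> m = 0.
Proof.
move=> h; apply: multiplier_eql => d; apply: nrm_eps0 => e e0.
have d1 : 0 < nrm d + 1 by rewrite ltr_wpDl ?nrm_ge0.
have [_ /(_ d) /le_trans] := h _ (divr_gt0 e0 d1); apply.
by rewrite mulrAC ler_pdivrMr // ler_wpM2l ?lerDl // ltW.
Qed.

Definition mcvg (u : nat -> multiplier D) m :=
  forall e, 0 < e -> exists N, forall n, (N <= n)%N -> opb (m - u n) e.

(** A pointwise limit of multipliers is again a double centralizer, because the
identity a m(b) = m(a) b passes to the limit on both sides. *)
Lemma mcvg_complete (u : nat -> multiplier D) (c : nat -> R) (C : R) :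
  (forall n, opb (u n.+1 - u n) (c n.+1 - c n)) -> (forall n, c n <= C) ->
  exists m, mcvg u m.
Proof.
move=> uc cC.
have ci n : c n <= c n.+1 by rewrite -subr_ge0; case: (uc n).
have pw (v : nat -> multiplier D) (vc : forall n, opb (v n.+1 - v n) (c n.+1 - c n)) d :
    exists l, forall e : R, 0 < e ->
      exists N, forall n, (N <= n)%N -> nrm (l - lmult (v n) d) <= e.
  apply: (@dominated_complete _ _ _ (fun n => c n * nrm d) (C * nrm d)) => n.
    by rewrite -mulrBl; case: (vc n) => _ /(_ d).
  by rewrite ler_wpM2r ?nrm_ge0.
have [f hf] := choice (pw u uc).
have uc' n : opb (star (u n.+1) - star (u n)) (c n.+1 - c n).
  by rewrite -starB; exact: opb_star.
have [g hg] := choice (pw _ uc').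
have fg a b : a ** f b = star (g (star a)) ** b.
  apply/eqP; rewrite -subr_eq0; apply/eqP/nrm_eps0 => e e0.
  have e1 : 0 < e / (nrm a + nrm b + 1).
    by rewrite divr_gt0 // ltr_wpDl ?addr_ge0 ?nrm_ge0.
  have [N1 h1] := hf b _ e1; have [N2 h2] := hg (star a) _ e1.
  set n := maxn N1 N2.
  have -> : a ** f b - star (g (star a)) ** b =
      a ** (f b - lmult (u n) b) - star (g (star a) - lmult (star (u n)) (star a)) ** b.
    rewrite smulBr starB smulBl mult_assoc opprB /= !starK.
    by rewrite subrKA.
  apply: le_trans (nrmB _ _) _.
  have := le_trans (nrmM a _) (ler_wpM2l (nrm_ge0 a) (h1 n (leq_maxl _ _))).
  have := ler_wpM2r (nrm_ge0 b) (h2 n (leq_maxr _ _)).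
  rewrite -nrm_star; move/(le_trans (nrmM _ b)) => A B.
  apply: le_trans (lerD B A) _.
  rewrite mulrC -mulrDr [leLHS]mulrAC ler_pdivrMr ?ltr_wpDl ?addr_ge0 ?nrm_ge0 //.
  by rewrite ler_wpM2l ?lerDl // ltW.
exists (Multiplier fg) => e e0.
have [N hN] := bounded_incr_cauchy ci cC e0.
exists N => n Nn; split=> [|d]; first exact: ltW.
apply/ler_addgt0Pr => s s0; have [K hK] := hf d _ s0.
pose k := maxn K n; have Kk : (K <= k)%N := leq_maxl _ _.
have nk : (n <= k)%N := leq_maxr _ _.
have := nrm_tri (lmult (u k) d) (f d) (lmult (u n) d).
have := hK _ Kk.
have : nrm (lmult (u k) d - lmult (u n) d) <= e * nrm d.
  have := @telescope_le _ _ (fun n => lmult (u n) d) (fun n => c n * nrm d) n (k - n).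
  rewrite subnKC // => /(_ _)/le_trans; apply.
    by move=> j; rewrite -mulrBl; case: (uc j) => _ /(_ d).
  rewrite -mulrBl ler_wpM2r ?nrm_ge0 //.
  have := hN _ (leq_trans Nn nk).
  have := @incr_le _ c N (n - N) ci; rewrite subnKC //; lra.
by rewrite lmultBl /=; lra.
Qed.

Lemma mcvg_comm (u : nat -> multiplier D) m x r : mcvg u x -> opb m r ->
  (forall n, m ** u n = u n ** m) -> m ** x = x ** m.
Proof.
move=> ux mr mu; apply/eqP; rewrite -subr_eq0; apply/eqP/opb_eps0 => e e0.
have r0 : 0 <= r by case: mr.
have e1 : 0 < e / (2 * r + 1) by rewrite divr_gt0 // ltr_wpDl ?mulr_ge0.
have [N /(_ _ (leqnn N)) hN] := ux _ e1.
have -> : m ** x - x ** m = m ** (x - u N) - (x - u N) ** m.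
  apply: multiplier_eql => d; have := congr1 (fun m => lmult m d) (mu N).
  rewrite !(lmultMl, lmultBl) lmultB => ->.
  by rewrite opprB subrKA.
apply: opb_le (opbB (opbM mr hN) (opbM hN mr)) _.
rewrite mulrC -mulrDr [leLHS]mulrAC ler_pdivrMr ?ltr_wpDl ?mulr_ge0 //.
by rewrite ler_wpM2l ?(ltW e0) //; lra.
Qed.

(** The embedding of D in M(D) is isometric by the C*-identity, so a limit in the
operator norm of elements of D is a limit in D. *)
Lemma mcvg_elt (a : nat -> D) x : mcvg (fun n => to_mult (a n)) x ->
  exists b, x = to_mult b.
Proof.
move=> ax.
have aab (n k : nat) e : opb (x - to_mult (a n)) e -> opb (x - to_mult (a k)) e ->
    nrm (a n - a k) <= e + e.
  move=> hn hm; apply: nrm_opb; rewrite to_multD to_multN.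
  have -> : to_mult (a n) - to_mult (a k) =
     (x - to_mult (a k)) - (x - to_mult (a n)).
    by rewrite opprB [RHS]addrC subrKA.
  exact: opbB.
have [|b hb] := @nrm_complete R D a.
  move=> e e0; have e20 : 0 < e / 2 by rewrite divr_gt0.
  have [N hN] := ax _ e20; exists N => n k Nn Nk.
  by have := aab n k _ (hN _ Nn) (hN _ Nk); rewrite -splitr.
exists b; apply/eqP; rewrite -subr_eq0; apply/eqP/opb_eps0 => e e0.
have e20 : 0 < e / 2 by rewrite divr_gt0.
have [N hN] := ax _ e20; have [K hK] := hb _ e20.
have := hN _ (leq_maxl N K); have := hK _ (leq_maxr N K).
set n := maxn _ _ => bn xn.
rewrite -(subrKA (to_mult (a n))) [e]splitr; apply: opbD => //.
rewrite -to_multN -to_multD; apply: opb_le (opb_to_mult _) _.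
by rewrite nrm_distC.
Qed.

End CStarBasics.

(** * Square roots in the multiplier algebra *)

Definition sqrt_iter (R : realType) (A : starAlgType R) (h : A) (n : nat) : A :=
  iter n (fun y => 2^-1%:C *: (h + y ** y)) 0.

(** The recursion of sqrt_iter for h = 1 in R; it increases to 1 and dominates
sqrt_iter h for every [h] of norm at most 1. *)
Definition sqrt_rate (R : realType) (n : nat) : R :=
  iter n (fun y => 2^-1 * (1 + y * y)) 0.

Section SquareRoot.
Variables (R : realType).

Lemma half_scale (V : lmodType R[i]) (x : V) : 2^-1%:C *: x + 2^-1%:C *: x = x.
Proof.
have e : 2^-1 + 2^-1 = 1 :> R by field.
by rewrite -scalerDl -rmorphD /= e scale1r.
Qed.

Lemma sqrt_rate_le1 n : 0 <= sqrt_rate R n <= 1.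
Proof.
elim: n => [|n /andP[a0 a1]]; first by rewrite lexx ler01.
by rewrite /sqrt_rate /= -/(sqrt_rate R n); apply/andP; split; nra.
Qed.

Lemma to_mult_sqrt_iter (D : cstarAlgType R) (h : D) n :
  to_mult (sqrt_iter h n) = sqrt_iter (to_mult h) n :> multiplier D.
Proof.
elim: n => [|n IH]; first exact: to_mult0.
by rewrite /sqrt_iter /= -!/(sqrt_iter _ n) to_multZ to_multD to_multM IH.
Qed.

Lemma sqrt_iter_comm (A : starAlgType R) (m h : A) n : m ** h = h ** m ->
  m ** sqrt_iter h n = sqrt_iter h n ** m.
Proof.
move=> mh; elim: n => [|n IH]; first by rewrite muls0 mul0s.
rewrite /sqrt_iter /= -/(sqrt_iter h n) smulZr smulZl smulDr smulDl mh smulA IH.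
by rewrite -smulA IH smulA.
Qed.

Lemma sqrt_iter_star (A : starAlgType R) (h : A) n : star h = h ->
  star (sqrt_iter h n) = sqrt_iter h n.
Proof.
move=> sh; elim: n => [|n IH]; first exact: stars0.
by rewrite /sqrt_iter /= -/(sqrt_iter h n) starZr starD starM sh IH.
Qed.

Variable D : cstarAlgType R.
Implicit Types (h x m : multiplier D).

Lemma sqrt_iter_opb h n : opb h 1 -> opb (sqrt_iter h n) (sqrt_rate R n).
Proof.
move=> h1; elim: n => [|n IH]; first exact: opb0.
rewrite /sqrt_iter /= -/(sqrt_iter h n) /sqrt_rate /= -/(sqrt_rate R n).
by apply: opbZr; rewrite ?invr_ge0 //; apply: opbD => //; exact: opbM.
Qed.

Lemma sqrt_iter_incr h n : opb h 1 ->
  opb (sqrt_iter h n.+1 - sqrt_iter h n) (sqrt_rate R n.+1 - sqrt_rate R n).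
Proof.
move=> h1; elim: n => [|n IH].
  rewrite subr0 [sqrt_rate _ 0]/sqrt_rate /= subr0.
  exact: (sqrt_iter_opb 1).
set x := sqrt_iter h n in IH *; set y := sqrt_iter h n.+1 in IH *.
have -> : sqrt_iter h n.+2 - y = 2^-1%:C *: (y ** (y - x) + (y - x) ** x).
  rewrite smulBr smulBl subrKA {2}/y /sqrt_iter !iterS -/(sqrt_iter h n.+1) -/x -/y.
  by rewrite -scalerBr opprD addrACA subrr add0r.
set a := sqrt_rate R n in IH *; set b := sqrt_rate R n.+1 in IH *.
have -> : sqrt_rate R n.+2 - b = 2^-1 * (b * (b - a) + (b - a) * a).
  have -> : sqrt_rate R n.+2 = 2^-1 * (1 + b * b) by [].
  have : b = 2^-1 * (1 + a * a) by [].
  by clearbody b; lra.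
apply: opbZr; rewrite ?invr_ge0 //.
by apply: opbD; apply: opbM => //; exact: sqrt_iter_opb.
Qed.

(** The iterates of y |-> (h + y^2)/2 starting from 0 converge as soon as
|h| <= 1, because their increments are dominated by those of the same recursion
for the number 1; the limit x satisfies (1 - x)^2 = 1 - h. *)
Lemma mult_sqrt h : opb h 1 -> exists x,
  [/\ mcvg (sqrt_iter h) x, opb x 1 & x + x = h + x ** x].
Proof.
move=> h1.
have [||x hx] := @mcvg_complete R D (sqrt_iter h) (sqrt_rate R) 1.
- by move=> n; exact: sqrt_iter_incr.
- by move=> n; case/andP: (sqrt_rate_le1 n).
have it1 n : opb (sqrt_iter h n) 1.
  by apply: opb_le (sqrt_iter_opb n h1) _; case/andP: (sqrt_rate_le1 n).
have x1 : opb x 1.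
  split=> // d; rewrite mul1r; apply/ler_addgt0Pr => e e0.
  have d1 : 0 < nrm d + 1 by rewrite ltr_wpDl ?nrm_ge0.
  have [N /(_ _ (leqnn N)) [_ /(_ d) hN]] := hx _ (divr_gt0 e0 d1).
  have [_ /(_ d)] := it1 N; rewrite mul1r.
  have := nrmD (lmult (x - sqrt_iter h N) d) (lmult (sqrt_iter h N) d).
  rewrite lmultBl subrK; rewrite lmultBl in hN.
  have : e / (nrm d + 1) * nrm d <= e.
    by rewrite mulrAC ler_pdivrMr // ler_wpM2l ?lerDl // ltW.
  by lra.
exists x; split => //.
suff xE : x = 2^-1%:C *: (h + x ** x) by rewrite {1 2}xE half_scale.
apply/eqP; rewrite -subr_eq0; apply/eqP/opb_eps0 => e e0.
have e20 : 0 < e / 2 by rewrite divr_gt0.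
have [N hN] := hx _ e20.
have hN0 := hN _ (leqnn N); have hN1 := hN _ (leqnSn N).
set y := sqrt_iter h N in hN0.
have -> : x - 2^-1%:C *: (h + x ** x) =
    (x - sqrt_iter h N.+1) - 2^-1%:C *: (x ** (x - y) + (x - y) ** y).
  rewrite smulBr smulBl subrKA /sqrt_iter iterS -/(sqrt_iter h N) -/y.
  rewrite -addrA -opprD -scalerDr; congr (_ - _ *: _).
  by rewrite [RHS]addrC addrA [RHS]addrAC subrK addrC.
have -> : e = e / 2 + 2^-1 * (1 * (e / 2) + (e / 2) * 1) by field.
apply: opbB => //; apply: opbZr; rewrite ?invr_ge0 //.
by apply: opbD; apply: opbM => //; exact: it1.
Qed.

End SquareRoot.

(** * Boundedness of *-representations *)

Section LinearMaps.
Variables (R : realType) (V W : lmodType R[i]) (f : V -> W).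
Hypothesis fl : linear f.

Lemma linD x y : f (x + y) = f x + f y.
Proof. by have := fl 1 x y; rewrite !scale1r. Qed.

Lemma lin0 : f 0 = 0.
Proof. by apply: (addrI (f 0)); rewrite -linD !addr0. Qed.

Lemma linZ k x : f (k *: x) = k *: f x.
Proof. by have := fl k x 0; rewrite lin0 !addr0. Qed.

Lemma linN x : f (- x) = - f x.
Proof. by rewrite -scaleN1r linZ scaleN1r. Qed.

Lemma linB x y : f (x - y) = f x - f y.
Proof. by rewrite linD linN. Qed.

End LinearMaps.

Section Forms.
Variables (R : realType) (B : cstarAlgType R) (Y : correspondence B).
Implicit Types x y z g k : Y.

Lemma nrm_ip_sqr x : nrm x ^+ 2 = nrm (ip x x).
Proof. by apply: (@complexI R); rewrite rmorphXn /= -!normE corr_norm. Qed.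

Lemma ipDr x y z : ip x (y + z) = ip x y + ip x z.
Proof. exact: (linD (ip_linear x)). Qed.

Lemma ipZr x (c : R[i]) y : ip x (c *: y) = c *: ip x y.
Proof. exact: (linZ (ip_linear x)). Qed.

Lemma ipNr x y : ip x (- y) = - ip x y.
Proof. exact: (linN (ip_linear x)). Qed.

Lemma ipDl x y z : ip (x + y) z = ip x z + ip y z.
Proof. by rewrite -!(ip_star z) ipDr starD. Qed.

Lemma ipZl (c : R[i]) x y : ip (c *: x) y = conjc c *: ip x y.
Proof. by rewrite -!(ip_star y) ipZr starZc. Qed.

Lemma ipNl x y : ip (- x) y = - ip x y.
Proof. by rewrite -!(ip_star y) ipNr starsN. Qed.

(** [g] is the mean of g + ik and g - ik, and both of these have the same
inner square as [z].  This replaces functional calculus throughout: it bounds a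
self-adjoint operator whose square has a commuting complement. *)
Lemma nrm_orth_part g k z :
  ip g k = ip k g -> ip g g + ip k k = ip z z -> nrm g <= nrm z.
Proof.
move=> gk gz.
have key (c : R[i]) : conjc c = - c -> c * c = -1 -> nrm (g + c *: k) = nrm z.
  move=> cc c2; apply/eqP; rewrite -(@eqrXn2 _ 2) ?nrm_ge0 //; apply/eqP.
  rewrite !nrm_ip_sqr -gz ipDr !ipDl !ipZr !ipZl cc gk !scaleNr scalerN scalerA c2.
  by rewrite scaleN1r opprK addrA subrK.
have i2 : 'i%C * 'i%C = -1 :> R[i] by rewrite -expr2 sqr_i.
have ci : conjc 'i%C = - 'i%C :> R[i] by apply/eqP; rewrite eq_complex /= oppr0 !eqxx.
have ci' : conjc (- 'i%C) = - - 'i%C :> R[i].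
  by apply/eqP; rewrite eq_complex /= !oppr0 !eqxx.
have u := key _ ci i2.
have v := key _ ci' (etrans (mulrNN _ _) i2).
have -> : g = 2^-1%:C *: ((g + 'i%C *: k) + (g + (- 'i%C) *: k)).
  by rewrite scaleNr addrACA subrr addr0 scalerDr half_scale.
rewrite nrmZr ?invr_ge0 //; apply: le_trans (ler_wpM2l _ (nrmD _ _)) _.
  by rewrite invr_ge0.
by rewrite u v; lra.
Qed.

End Forms.

Section Polarization.
Variables (R : realType) (B : cstarAlgType R) (Y : correspondence B).
Implicit Types x y : Y.

Lemma polarization x y :
  4%:C *: ip x y =
    (ip (x + y) (x + y) - ip (x - y) (x - y))
    - 'i%C *: (ip (x + 'i%C *: y) (x + 'i%C *: y)
               - ip (x - 'i%C *: y) (x - 'i%C *: y)).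
Proof.
have key (z : Y) : ip (x + z) (x + z) - ip (x - z) (x - z) =
    2%:C *: (ip x z + ip z x).
  rewrite !ipDr !ipDl !ipNr !ipNl opprK; set a := ip x x; set b := ip x z.
  set c := ip z x; set d := ip z z.
  have -> : 2%:C *: (b + c) = (b + c) + (b + c).
    by rewrite -[2]/(1 + 1) rmorphD scalerDl rmorph1 scale1r.
  rewrite opprD [- (a - c)]opprB opprD opprK.
  rewrite addrACA [a + c]addrC (addrACA c a) subrr addr0 (addrACA b d) subrr addr0.
  by rewrite [RHS]addrACA addrC.
rewrite !key ipZr ipZl; set p := ip x y; set q := ip y x.
have i2 : 'i%C * 'i%C = -1 :> R[i] by rewrite -expr2 sqr_i.
have ci : 'i%C * conjc 'i%C = 1 :> R[i].
  by rewrite -sqr_normc normE nrm_i rmorph1 expr1n.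
have -> : 'i%C *: (2%:C *: ('i%C *: p + conjc 'i%C *: q)) = 2%:C *: (q - p).
  rewrite scalerA [_ * 2%:C]mulrC -scalerA scalerDr !scalerA i2 ci.
  by rewrite scaleN1r scale1r addrC.
rewrite -scalerBr opprB addrACA subrr addr0 -{2 3}[p]scale1r -scalerDl scalerA.
by congr (_ *: _); apply/eqP; rewrite eq_complex /=; apply/andP; split; apply/eqP; ring.
Qed.

(** A weak form of the Cauchy-Schwarz inequality, for which polarization is
enough. *)
Lemma nrm_ip x y : nrm (ip x y) <= 4 * (nrm x * nrm y).
Proof.
have unit (u v : Y) : nrm u = 1 -> nrm v = 1 -> nrm (ip u v) <= 4 :> R.
  move=> u1 v1; rewrite -(@ler_pM2l _ 4) // -[leLHS]nrmZr // polarization.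
  have b (z : Y) : nrm z = 1 -> nrm (ip (u + z) (u + z)) <= 4.
    move=> z1; rewrite -nrm_ip_sqr; have := nrmD u z; have := nrm_ge0 (u + z).
    by rewrite u1 z1; nra.
  have Nv w : nrm (- w : Y) = nrm w by exact: nrmN.
  have iv : nrm ('i%C *: v) = 1 by rewrite nrmZ nrm_i v1 mulr1.
  apply: le_trans (nrmB _ _) _; rewrite nrmZ nrm_i mul1r.
  apply: le_trans (lerD (nrmB _ _) (nrmB _ _)) _.
  have := b v v1; have := b (- v); rewrite nrmN v1 => /(_ erefl).
  have := b _ iv; have := b (- ('i%C *: v)); rewrite nrmN iv => /(_ erefl).
  lra.
have [->|x0] := eqVneq x 0.
  by rewrite -(scale0r (0 : Y)) ipZl rmorph0 scale0r nrm0 scale0r nrm0 mul0r mulr0.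
have [->|y0] := eqVneq y 0.
  by rewrite -(scale0r (0 : Y)) ipZr scale0r nrm0 scale0r nrm0 mulr0 mulr0.
rewrite -nrm_gt0 in x0; rewrite -nrm_gt0 in y0.
have n1 (z : Y) : 0 < nrm z -> nrm ((nrm z)^-1%:C *: z) = 1.
  by move=> z0; rewrite nrmZr ?invr_ge0 ?ltW // mulVf // gt_eqF.
have := unit _ _ (n1 _ x0) (n1 _ y0).
rewrite ipZl ipZr conjc_real scalerA -rmorphM /= nrmZr; last first.
  by rewrite mulr_ge0 ?invr_ge0 ?nrm_ge0.
by rewrite -invfM mulrC ler_pdivrMr ?mulr_gt0.
Qed.

End Polarization.

Section BoundedRepresentations.
Variables (R : realType).

Lemma mcvg_star (D : cstarAlgType R) (u : nat -> multiplier D) m :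
  mcvg u m -> (forall n, star (u n) = u n) -> star m = m.
Proof.
move=> um su; apply/eqP; rewrite -subr_eq0; apply/eqP/opb_eps0 => e e0.
have e20 : 0 < e / 2 by rewrite divr_gt0.
have [N /(_ _ (leqnn N)) hN] := um _ e20.
rewrite -(subrKA (u N)) [e]splitr; apply: opbD.
  by rewrite -{1}(su N) -starB; exact: opb_star.
by rewrite -opprB; exact: opbN.
Qed.

(** If a = a* and |a| <= 1 then 1 - c is the square root of 1 - a^2. *)
Lemma elt_sqrt (A : cstarAlgType R) (a : A) : star a = a -> nrm a <= 1 ->
  exists c, [/\ star c = c, a ** c = c ** a & c + c = a ** a + c ** c].
Proof.
move=> sa a1.
have aa1 : opb (to_mult (a ** a)) 1.
  apply: opb_le (opb_to_mult _) _; apply: le_trans (nrmM _ _) _.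
  by have := nrm_ge0 a; nra.
have [x [cx _ xE]] := mult_sqrt aa1.
have sit n : star (sqrt_iter (to_mult (a ** a)) n) = sqrt_iter (to_mult (a ** a)) n.
  by apply: sqrt_iter_star; rewrite -to_mult_star starM sa.
have sx := mcvg_star cx sit.
have ax : to_mult a ** x = x ** to_mult a.
  apply: (mcvg_comm cx (opb_to_mult a)) => n.
  by apply: sqrt_iter_comm; rewrite -!to_multM smulA.
have cx' : mcvg (fun n => to_mult (sqrt_iter (a ** a) n)) x.
  by move=> e /cx[N hN]; exists N => n /hN; rewrite to_mult_sqrt_iter.
have [c xc] := mcvg_elt cx'; exists c; move: sx ax xE; rewrite xc => sx ax xE.
split; apply: to_mult_inj; first by rewrite to_mult_star.
  by rewrite !to_multM.
by rewrite !to_multD !to_multM xE to_multM.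
Qed.

(** For [a] self-adjoint of norm at most 1 this is nrm_orth_part: the
complement of rho(a)x is rho(sqrt(1 - a^2))x, written x - rho(c)x since sqrt(1 - a^2)
need not lie in A.  The general case follows by applying this to a*a; the factor 2
comes from the constant 4 in nrm_ip, and only boundedness matters in the sequel. *)
Lemma star_rep_bounded (A B : cstarAlgType R) (Y : correspondence B)
    (rho : A -> Y -> Y) :
  (forall x, linear (rho^~ x)) ->
  (forall a b x, rho (a ** b) x = rho a (rho b x)) ->
  (forall a x y, ip (rho a x) y = ip x (rho (star a) y)) ->
  forall a x, nrm (rho a x) <= 2 * nrm a * nrm x.
Proof.
move=> rl rM radj.
have unit a x : star a = a -> nrm a <= 1 -> nrm (rho a x) <= nrm x.
  move=> sa a1; have [c [sc ac cc]] := elt_sqrt sa a1.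
  apply: (@nrm_orth_part _ _ _ _ (x - rho c x)).
    rewrite ipDr ipDl ipNr ipNl !radj sa sc -!rM.
    by rewrite ac.
  rewrite ipDr !ipDl !ipNr !ipNl !radj sa sc -!rM.
  have -> : ip x (rho (a ** a) x) = ip x (rho c x) + ip x (rho c x) - ip x (rho (c ** c) x).
    by rewrite -ipDr -(linD (rl x)) cc (linD (rl x)) ipDr addrK.
  set p := ip x (rho c x); set q := ip x (rho (c ** c) x); set n := ip x x.
  have -> : n - p + (- p - - q) = n - (p + p - q) by rewrite !opprD !opprK !addrA.
  by rewrite addrC subrK.
have sa_bound a x : star a = a -> nrm (rho a x) <= nrm a * nrm x.
  move=> sa; have [->|a0] := eqVneq a 0.
    by rewrite (lin0 (rl x)) !nrm0 mul0r.
  rewrite -nrm_gt0 in a0.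
  have i0 : 0 <= (nrm a)^-1 by rewrite invr_ge0 ltW.
  have := unit ((nrm a)^-1%:C *: a) x; rewrite starZr sa => /(_ erefl).
  rewrite nrmZr // mulVf ?gt_eqF // => /(_ (lexx _)).
  by rewrite (linZ (rl x)) nrmZr // ler_pdivrMl.
move=> a x; rewrite -(@ler_pXn2r _ 2) ?nnegrE ?mulr_ge0 ?nrm_ge0 //.
rewrite nrm_ip_sqr radj -rM; apply: le_trans (nrm_ip _ _) _.
have := sa_bound (star a ** a) x; rewrite starM starK => /(_ erefl).
rewrite nrm_cstar => h.
have := ler_wpM2l (nrm_ge0 x) h; lra.
Qed.

(** Lets the inequalities for correspondences be used for left multiplication
on an algebra, with star x ** y as the inner product. *)
Definition self_corr (D : cstarAlgType R) : correspondence D.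
Proof.
refine (@Correspondence R D (D : completeNormedModType R[i])
  (fun x b => x ** b) (fun b x => b ** x) (fun x y => star x ** y)
  _ _ _ _ _ _ _ _ _ _ _ _).
- by move=> b k x y /=; rewrite smulDl smulZl.
- by move=> x k a b; rewrite smulDr smulZr.
- by move=> x a b; rewrite smulA.
- by move=> x k a b; rewrite smulDr smulZr.
- by move=> x y; rewrite starM starK.
- by move=> x y b; rewrite smulA.
- by move=> x; exists x.
- by move=> x; rewrite cstar_normE.
- by move=> x k a b; rewrite smulDl smulZl.
- by move=> b k x y; rewrite smulDr smulZr.
- by move=> a b x; rewrite smulA.
- by move=> b x y; rewrite starM smulA.
Defined.

Lemma mult_starhom_bounded (A D : cstarAlgType R) (f : A -> multiplier D) :
  is_starhom f -> forall a, opb (f a) (2 * nrm a).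
Proof.
move=> [fl fM fs] a; split; first by rewrite mulr_ge0 ?nrm_ge0.
apply: (@star_rep_bounded A D (self_corr D) (fun a d => lmult (f a) d)).
- by move=> x k b c; rewrite fl.
- by move=> b c x; rewrite fM.
- by move=> b x y; rewrite fs; exact: lmult_adj.
Qed.

Lemma to_mult_starhom (A D : cstarAlgType R) (f : A -> D) :
  is_starhom f -> is_starhom (fun a => to_mult (f a) : multiplier D).
Proof.
move=> [fl fM fs]; split.
- by move=> k a b; rewrite fl to_multD to_multZ.
- by move=> a b; rewrite fM to_multM.
- by move=> a; rewrite fs to_mult_star.
Qed.

Lemma starhom_bounded (A D : cstarAlgType R) (f : A -> D) :
  is_starhom f -> forall a, nrm (f a) <= 2 * nrm a.
Proof.
move=> /to_mult_starhom/mult_starhom_bounded h a; exact: nrm_opb.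
Qed.

Lemma lact_bounded (B : cstarAlgType R) (Y : correspondence B) (b : B) (x : Y) :
  nrm (lact b x) <= 2 * nrm b * nrm x.
Proof.
apply: (@star_rep_bounded B B Y (@lact _ _ Y)).
- exact: lact_linearl.
- exact: lactM.
- exact: lact_adj.
Qed.

Lemma mult_orth_part (D : cstarAlgType R) (g k z : multiplier D) r :
  star g = g -> star k = k -> star z = z -> g ** k = k ** g ->
  g ** g + k ** k = z ** z -> opb z r -> opb g r.
Proof.
move=> sg sk sz gk gz [r0 hz]; split=> // d; apply: le_trans (hz d).
apply: (@nrm_orth_part _ _ (self_corr D) _ (lmult k d)) => /=.
  by rewrite !lmult_adj sg sk -!lmultMl gk.
by rewrite !lmult_adj sg sk sz -!lmultMl -gz lmultDl smulDr.
Qed.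

End BoundedRepresentations.

(** * Positivity without spectral theory *)

Section Positivity.
Variables (R : realType) (D : cstarAlgType R).
Implicit Types (b f g k m s x : multiplier D).
Local Notation one := (mult_one : multiplier D).

Lemma mul1m m : one ** m = m. Proof. exact: multiplier_eql. Qed.
Lemma mulm1 m : m ** one = m. Proof. exact: multiplier_eql. Qed.
Lemma star_one : star one = one.
Proof. by apply: multiplier_eql => d /=; rewrite starK. Qed.

Lemma sqr_one_minus x : (one - x) ** (one - x) = one - (x + x - x ** x).
Proof. by rewrite smulBr !smulBl !mulm1 !mul1m !opprD !opprK !addrA. Qed.

(** For r = 1 the multiplier 1 - g^2 is the square of k = sqrt(1 - g^2), and |k| <= 1
because g^2 + k^2 = 1. *)
Lemma square_gap g r : star g = g -> 0 < r -> opb g r ->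
  opb ((r ^+ 2)%:C *: one - g ** g) (r ^+ 2).
Proof.
move=> sg r0 gr; have ri : 0 <= r^-1 by rewrite invr_ge0 ltW.
pose g' : multiplier D := r^-1%:C *: g.
have g'1 : opb g' 1 by rewrite -(@mulVf _ r) ?gt_eqF //; exact: opbZr.
have sg' : star g' = g' by rewrite starZr sg.
have h1 : opb (g' ** g') 1 by rewrite -[1]mul1r; exact: opbM.
have [x [cx _ xE]] := mult_sqrt h1.
have sx : star x = x.
  by apply: (mcvg_star cx) => n; apply: sqrt_iter_star; rewrite starM sg'.
have gx : g' ** x = x ** g'.
  by apply: (mcvg_comm cx g'1) => n; apply: sqrt_iter_comm; rewrite smulA.
have kk : (one - x) ** (one - x) = one - g' ** g'.
  by rewrite sqr_one_minus xE addrK.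
have k1 : opb (one - x) 1.
  apply: (@mult_orth_part _ _ _ g' one 1); rewrite ?starB ?sx ?star_one //.
  - by rewrite smulBl smulBr mul1m mulm1 gx.
  - by rewrite kk subrK mul1m.
  - exact: opb1.
have -> : (r ^+ 2)%:C *: one - g ** g = (r ^+ 2)%:C *: ((one - x) ** (one - x)).
  rewrite kk scalerBr smulZl smulZr !scalerA -!rmorphM /=.
  by congr (_ - _); rewrite -[LHS]scale1r; congr (_%:C *: _); field; rewrite gt_eqF.
rewrite -[X in opb _ X]mulr1; apply: opbZr; first by rewrite exprn_ge0 // ltW.
by rewrite -[1]mul1r; exact: opbM.
Qed.

(** [b] is positive: b = b* and the spectrum of [b] lies in [0, 2t], expressed
by a norm inequality which is visibly stable under sums. *)
Definition mpos b :=
  star b = b /\ exists2 t : R, 0 < t & opb (t%:C *: one - b) t.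

Lemma mpos_sqrt b : mpos b -> exists k, [/\ mpos k, k ** k = b
  & forall m r, opb m r -> m ** b = b ** m -> m ** k = k ** m].
Proof.
move=> [sb [t t0 bt]]; have ti : 0 <= t^-1 by rewrite invr_ge0 ltW.
pose h : multiplier D := one - t^-1%:C *: b.
have h1 : opb h 1.
  rewrite -(@mulVf _ t) ?gt_eqF //.
  have -> : h = t^-1%:C *: (t%:C *: one - b).
    by rewrite scalerBr scalerA -rmorphM /= mulVf ?gt_eqF // scale1r.
  exact: opbZr.
have [x [cx x1 xE]] := mult_sqrt h1.
have sx : star x = x.
  by apply: (mcvg_star cx) => n; apply: sqrt_iter_star; rewrite starB starZr sb star_one.
have q0 : 0 < Num.sqrt t by rewrite sqrtr_gt0.
exists ((Num.sqrt t)%:C *: (one - x)); split.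
- split; first by rewrite starZr starB sx star_one.
  exists (Num.sqrt t) => //; rewrite -scalerBr subKr -[X in opb _ X]mulr1.
  by apply: opbZr => //; exact: ltW.
- rewrite smulZl smulZr scalerA -rmorphM /= -expr2 sqr_sqrtr ?ltW // sqr_one_minus.
  by rewrite xE addrK subKr scalerA -rmorphM /= mulfV ?gt_eqF // scale1r.
- move=> m r mr mb; rewrite smulZl smulZr smulBl smulBr mul1m mulm1.
  congr (_ *: (_ - _)); apply: (mcvg_comm cx mr) => n; apply: sqrt_iter_comm.
  by rewrite smulBl smulBr mul1m mulm1 smulZl smulZr mb.
Qed.

(** The radius in mpos may be lowered to any bound for the norm: b is the square
of a self-adjoint k, to which square_gap applies. *)
Lemma mpos_gap b r : mpos b -> 0 < r -> opb b r -> opb (r%:C *: one - b) r.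
Proof.
move=> /mpos_sqrt[k [[sk _] kb _]] r0 br.
have q0 : 0 < Num.sqrt r by rewrite sqrtr_gt0.
have := @square_gap k (Num.sqrt r) sk q0; rewrite sqr_sqrtr ?ltW // kb; apply.
by apply: opb_cstar; rewrite ?ltW // sk kb sqr_sqrtr // ltW.
Qed.

Lemma mpos_sqr g r : star g = g -> opb g r -> mpos (g ** g).
Proof.
move=> sg gr; split; first by rewrite starM sg.
have r0 : 0 <= r by case: gr.
have r1 : 0 < r + 1 by rewrite ltr_wpDl.
exists ((r + 1) ^+ 2); first by rewrite exprn_gt0.
by apply: square_gap => //; apply: opb_le gr _; rewrite lerDl.
Qed.

Lemma opb_square_eq0 f : star f = f -> f ** f = 0 -> f = 0.
Proof.
move=> sf ff; apply: multiplier_eql => d; apply: star_smul_eq0.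
by rewrite lmult_adj sf -lmultMl ff lmult0l smulr0.
Qed.

Lemma double2 (V : lmodType R[i]) (v : V) : 2%:C *: v = v + v.
Proof. by rewrite -[2]/(1 + 1) rmorphD scalerDl rmorph1 scale1r. Qed.

(** The usual proof compares the spectra of y* y and y y*; here it is made
quantitative.  Up to a factor 2, b = y y* is a sum of squares of self-adjoint
elements, so it is positive, of norm 1, and |1 - b| <= 1.  Hence
(1 + g^2) y* = y* (1 - b) has norm at most 1, and so has X = g + g^3, because
X^2 = - (1 + g^2) y* y (1 + g^2).  But X^2 = (2 g^2)^2 + (g - g^3)^2 forces
|2 g^2| <= |X| <= 1, whereas |g^2| = |y|^2 = 1. *)
Lemma minus_square_normalized (y : D) g : nrm y = 1 -> star g = g ->
  to_mult (star y ** y) = - (g ** g) -> False.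
Proof.
move=> y1 sg yg; have [s gg] : exists s, g ** g = s by exists (g ** g).
rewrite gg in yg; set Y := to_mult y : multiplier D.
have YY : star Y ** Y = - s by rewrite -to_mult_star -to_multM.
have sE : s = to_mult (- (star y ** y)) by rewrite to_multN yg opprK.
have s1 : opb s 1.
  by rewrite sE; have := opb_to_mult (- (star y ** y)); rewrite nrmN nrm_cstar y1 expr1n.
have g1 : opb g 1 by apply: opb_cstar; rewrite // sg expr1n gg.
have Y1 : opb Y 1 by rewrite -y1; exact: opb_to_mult.
have sY1 := opb_star Y1.
pose B : multiplier D := Y ** star Y.
have sB : star B = B by rewrite starM starK.
have B1 : opb B 1 by rewrite -[1]mul1r; exact: opbM.
pose x1 : multiplier D := Y + star Y.
pose x2 : multiplier D := 'i%C *: (Y - star Y).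
have x1s : star x1 = x1 by rewrite starD starK addrC.
have x2s : star x2 = x2.
  rewrite /x2 starZc starB starK -[Y - star Y]opprB scalerN -scaleNr; congr (_ *: _).
  by apply/eqP; rewrite eq_complex /= oppr0 !eqxx.
have x1b : opb x1 2 by have := opbD Y1 sY1.
have x2b : opb x2 2 by have := opbZ 'i%C (opbB Y1 sY1); rewrite nrm_i mul1r.
(* x1^2 + x2^2 = 2(y y* + y* y), and y* y = - g^2. *)
have BE : B + B = x1 ** x1 + x2 ** x2 + (s + s).
  have i2 : 'i%C * 'i%C = -1 :> R[i] by rewrite -expr2 sqr_i.
  rewrite /x2 smulZl smulZr scalerA i2 scaleN1r /x1.
  rewrite !(smulDl, smulDr, mulNs, mulsN) YY -/B !opprB.
  set c := Y ** Y; set d := star Y ** star Y.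
  have -> : c + B + (- s + d) + (- s - d + (B - c)) = (B + B) - (s + s).
    rewrite [- s - d + _]addrC addrACA [c + B]addrC (addrACA B c) subrr addr0.
    by rewrite (addrACA (- s) d) subrr addr0 -opprD.
  by rewrite subrK.
have sub2 (a b c d : multiplier D) : (a - b) + (c - d) = (a + c) - (b + d).
  by rewrite addrACA opprD.
have Bpos : mpos B.
  split=> //; exists 5 => //.
  have e2 : 0 <= 2^-1 :> R by rewrite invr_ge0.
  have -> : 5%:C *: one - B = 2^-1%:C *: (((2 ^+ 2)%:C *: one - x1 ** x1)
     + ((2 ^+ 2)%:C *: one - x2 ** x2) + (((1 ^+ 2)%:C *: one - s) + ((1 ^+ 2)%:C *: one - s))).
    rewrite -[B]half_scale -scalerDr BE !sub2 [in RHS]scalerBr; congr (_ - _).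
    by rewrite -!scalerDl -!rmorphD scalerA -rmorphM /=; congr (_%:C *: _); field.
  have -> : 5 = 2^-1 * ((2 ^+ 2 + 2 ^+ 2) + (1 ^+ 2 + 1 ^+ 2)) :> R by field.
  apply: opbZr => //; by rewrite -gg; apply: opbD; apply: opbD; apply: square_gap.
have gap : opb (one - B) 1.
  by have := mpos_gap Bpos ltr01 B1; rewrite rmorph1 scale1r.
pose Z : multiplier D := star Y ** (one - B).
have ZE : Z = star Y + s ** star Y.
  by rewrite /Z smulBr mulm1 smulA YY mulNs opprK.
have Z1 : opb Z 1 by rewrite -[1]mul1r; exact: opbM.
pose X := g + s ** g.
have ss : star s = s by rewrite -gg starM sg.
have gs : g ** s = s ** g by rewrite -gg smulA.
have sX : star X = X by rewrite starD starM sg ss gs.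
have sgg m : m ** g ** g = m ** s by rewrite -smulA gg.
have sgs m : m ** g ** s = m ** s ** g by rewrite -smulA gs smulA.
have XE : X ** X = s + s ** s + (s ** s + s ** s ** s).
  by rewrite !(smulDl, smulDr) !smulA sgs !sgg gs sgg gg.
have X1 : opb X 1.
  apply: opb_cstar => //; rewrite sX expr1n.
  have -> : X ** X = - (Z ** star Z).
    rewrite XE ZE starD starM starK ss !(smulDl, smulDr) !smulA YY.
    rewrite -[s ** star Y ** Y]smulA YY !(mulNs, mulsN) !opprD !opprK.
    done.
  by apply: opbN; rewrite -[1]mul1r; apply: opbM => //; exact: opb_star.
(* (2 g^2)^2 + (g - g^3)^2 = (g + g^3)^2 *)
have : opb (s + s) 1.
  apply: (@mult_orth_part _ _ _ (g - s ** g) X) => //.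
  - by rewrite starD ss.
  - by rewrite starB starM sg ss gs.
  - by rewrite !(smulDl, smulDr, mulNs, mulsN) !smulA gs sgs.
  - rewrite XE !(smulDl, smulDr, mulNs, mulsN) !smulA sgs !sgg gs sgg gg.
    set q := s ** s; rewrite opprB sub2 [LHS]addrC addrA subrK.
    by rewrite [q + _]addrC addrACA.
rewrite sE -to_multD => /nrm_opb; rewrite -opprD nrmN -double2 nrmZr //.
by rewrite nrm_cstar y1 expr1n; lra.
Qed.

Lemma minus_square_eq0 (y : D) g : star g = g ->
  to_mult (star y ** y) = - (g ** g) -> y = 0.
Proof.
move=> sg yg; have [//|y0] := eqVneq y 0; exfalso.
rewrite -nrm_gt0 in y0; have i0 : 0 <= (nrm y)^-1 by rewrite invr_ge0 ltW.
apply: (@minus_square_normalized ((nrm y)^-1%:C *: y) ((nrm y)^-1%:C *: g)).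
- by rewrite nrmZr // mulVf // gt_eqF.
- by rewrite starZr sg.
- rewrite starZr !(smulZl, smulZr) !to_multZ yg.
  by rewrite !scalerN.
Qed.

(** Put s = x* x = - y* y
and f = |s| + s, twice the positive part of s.  Then f s f is the square of
|s|^(1/2) f, while it equals - (y f)* (y f), so that y f = 0 by minus_square_eq0.  This
gives f = 0, that is s = - |s|, and minus_square_eq0 applies again, to x. *)
Lemma sum_squares_eq0 (x y : D) : star x ** x + star y ** y = 0 -> x = 0.
Proof.
move=> xy; set s := to_mult (star x ** x) : multiplier D.
have yE : to_mult (star y ** y) = - s.
  by apply/eqP; rewrite -addr_eq0 addrC -to_multD xy to_mult0.
have ss : star s = s by rewrite -to_mult_star starM starK.
have sb : opb s _ := opb_to_mult _.
have [a [apos aa ac]] := mpos_sqrt (mpos_sqr ss sb).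
have sa : star a = a by case: apos.
have [l [[sl _] ll lc]] := mpos_sqrt apos.
have sas : s ** a = a ** s by apply: (ac _ _ sb); rewrite smulA.
have sls : s ** l = l ** s by apply: (lc _ _ sb).
have al : a ** l = l ** a by rewrite -ll smulA.
pose f : multiplier D := a + s.
have sf : star f = f by rewrite starD sa ss.
have lf : l ** f = f ** l by rewrite smulDl smulDr al sls.
have fsf : f ** s ** f = (l ** f) ** (l ** f).
  rewrite {1}lf smulA -[f ** l ** l]smulA ll; congr (_ ** f).
  by rewrite /f !smulDl sas aa addrC.
have ry : rmult f y = 0.
  apply: (@minus_square_eq0 _ (l ** f)); first by rewrite starM sf sl lf.
  rewrite to_multM to_mult_star -rmult_to_mult starM sf smulA.
  by rewrite -[f ** _ ** _]smulA -to_mult_star -to_multM yE mulsN mulNs fsf.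
have fsf0 : f ** s ** f = 0.
  have : to_mult (star (rmult f y) ** rmult f y) = 0 by rewrite ry smulr0 to_mult0.
  rewrite to_multM to_mult_star -rmult_to_mult starM sf smulA.
  rewrite -[f ** _ ** _]smulA -to_mult_star -to_multM yE mulsN mulNs.
  by move/eqP; rewrite oppr_eq0 => /eqP.
have sf_af : s ** f = a ** f by rewrite /f !smulDr sas aa addrC.
have ff : f ** f = a ** f + a ** f by rewrite {1}/f smulDl sf_af.
have fs : f ** s = a ** f by rewrite /f smulDl smulDr aa addrC.
have f0 : f = 0.
  apply: opb_square_eq0 => //; apply: opb_square_eq0; first by rewrite starM sf.
  by rewrite smulA ff smulDl -fs fsf0 addr0 mul0s.
have sE : s = - a by apply/eqP; rewrite -addr_eq0 addrC -/f f0.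
by apply: (@minus_square_eq0 _ l) => //; rewrite ll -sE.
Qed.

End Positivity.

(** * A *-homomorphism with dense range is onto *)

Section DenseRange.
Variable R : realType.

Lemma expr_small (q : R) e : 0 <= q -> q < 1 -> 0 < e ->
  exists N, forall n, (N <= n)%N -> q ^+ n <= e.
Proof.
move=> q0 q1 e0; have qn : `|q| < 1 by rewrite ger0_norm.
move: (cvg_expr qn) => /cvgrPdist_le/(_ e e0)[N _ hN].
by exists N => n /hN; rewrite sub0r normrN ger0_norm // exprn_ge0.
Qed.

Lemma geometric_complete (V : completeNormedModType R[i]) (u : nat -> V) (q C : R) :
  0 <= q -> q < 1 -> (forall n, nrm (u n.+1 - u n) <= C * q ^+ n) ->
  exists l, forall e : R, 0 < e ->
    exists N, forall n, (N <= n)%N -> nrm (l - u n) <= e.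
Proof.
move=> q0 q1 uq; have q10 : 0 < 1 - q by rewrite subr_gt0.
have C0 : 0 <= C by have := le_trans (nrm_ge0 _) (uq 0%N); rewrite expr0 mulr1.
apply: (@dominated_complete _ _ _ (fun n => C / (1 - q) * (1 - q ^+ n)) (C / (1 - q))).
  move=> n; apply: le_trans (uq n) _; rewrite exprS le_eqVlt; apply/orP; left.
  by apply/eqP; field; rewrite gt_eqF.
move=> n; rewrite -[leRHS]mulr1 ler_wpM2l ?divr_ge0 ?(ltW q10) //.
by rewrite gerBl exprn_ge0.
Qed.

(** For r >= |t|^2 the map z |-> (t + (r - t^2) z)/(r + 1) is a contraction with
factor r/(r + 1), by square_gap; its fixed point solves z + t^2 z = t. *)
Lemma resolvent_exists (D : cstarAlgType R) (t : D) : star t = t ->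
  exists z, z + t ** t ** z = t.
Proof.
move=> st; pose a := nrm t + 1; have a0 : 0 < a by rewrite ltr_wpDl ?nrm_ge0.
set r := a ^+ 2; have r0 : 0 < r by rewrite exprn_gt0.
have r1 : 0 < r + 1 by rewrite ltr_wpDl // ltW.
pose W : multiplier D := r%:C *: mult_one - to_mult t ** to_mult t.
have Wr : opb W r.
  apply: square_gap => //; first by rewrite -to_mult_star st.
  by apply: opb_le (opb_to_mult t) _; rewrite lerDl.
pose F z := (r + 1)^-1%:C *: (t + lmult W z).
pose q := r / (r + 1).
have q0 : 0 <= q by rewrite divr_ge0 ?ltW.
have q1 : q < 1 by rewrite ltr_pdivrMr // mul1r ltrDl.
have Fq x y : nrm (F x - F y) <= q * nrm (x - y).
  rewrite /F -scalerBr opprD addrACA subrr add0r -lmultB nrmZr ?invr_ge0 ?(ltW r1) //.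
  by rewrite /q [r / _]mulrC -mulrA ler_wpM2l ?invr_ge0 ?(ltW r1) //; case: Wr.
have [|z hz] := @geometric_complete D (fun n => iter n F 0) q (nrm (F 0 - 0)) q0 q1.
  elim=> [|n IH]; first by rewrite expr0 mulr1.
  rewrite exprS mulrCA; apply: le_trans (Fq _ _) _.
  by rewrite ler_wpM2l.
have zF : z = F z.
  apply/eqP; rewrite -subr_eq0; apply/eqP/nrm_eps0 => e e0.
  have e20 : 0 < e / 2 by rewrite divr_gt0.
  have [N hN] := hz _ e20; have := hN _ (leqnSn N); have := hN _ (leqnn N).
  have := nrm_tri (iter N.+1 F 0) z (F z); have := Fq (iter N F 0) z.
  rewrite [nrm (iter N F 0 - z)]nrm_distC /=.
  by have := nrm_ge0 (z - iter N F 0); nra.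
exists z; have : (r + 1)%:C *: z = t + lmult W z.
  by rewrite {1}zF scalerA -rmorphM /= mulfV ?gt_eqF // scale1r.
rewrite lmultBl lmultZl /= rmorphD rmorph1 scalerDl scale1r addrCA => /addrI zt.
by rewrite {1}zt smulA subrK.
Qed.

Lemma resolvent_unique (D : cstarAlgType R) (t v : D) : star t = t ->
  v + t ** t ** v = 0 -> v = 0.
Proof.
move=> st v0; apply: (@sum_squares_eq0 _ _ _ (t ** v)).
by rewrite starM st -!smulA -smulDr !smulA v0 smulr0.
Qed.

(** For self-adjoint [t] the solution z = t/(1 + t^2) is self-adjoint of norm at
most 1/2 whatever the norm of [t] is: 1 - 2tz and 2z are the real and imaginary
parts of the Cayley transform (1 + it)/(1 - it). *)
Lemma resolvent_bound (D : cstarAlgType R) (t z : D) : star t = t ->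
  z + t ** t ** z = t -> star z = z /\ nrm (z + z) <= 1.
Proof.
move=> st zt.
have tz : t ** z = z ** t.
  apply/eqP; rewrite -subr_eq0; apply/eqP/(resolvent_unique st).
  have -> : t ** z - z ** t + t ** t ** (t ** z - z ** t) =
      t ** (z + t ** t ** z) - (z + t ** t ** z) ** t.
    by rewrite !(smulDl, smulDr, mulsN) opprD addrACA !smulA.
  by rewrite zt subrr.
have sz : star z = z.
  apply/eqP; rewrite -subr_eq0; apply/eqP/(resolvent_unique st).
  have zt' : star z + t ** t ** star z = t.
    have : star (z + z ** t ** t) = t.
      by rewrite -tz -smulA -tz smulA zt.
    by rewrite starD !starM st smulA.
  by rewrite smulBr addrACA -opprD zt' zt subrr.
split=> //; apply: nrm_opb; rewrite to_multD.
set Z := to_mult z : multiplier D; set T := to_mult t : multiplier D.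
have sZ : star Z = Z by rewrite -to_mult_star sz.
have sT : star T = T by rewrite -to_mult_star st.
have TZ : T ** Z = Z ** T by rewrite -!to_multM tz.
have ZT : Z + T ** T ** Z = T by rewrite -!to_multM -to_multD zt.
pose w := T ** Z + T ** Z.
have sw : star w = w by rewrite starD starM sZ sT -TZ.
apply: (@mult_orth_part _ _ _ (mult_one - w) mult_one 1).
- by rewrite starD sZ.
- by rewrite starB sw star_one.
- exact: star_one.
- rewrite smulBl smulBr mul1m mulm1; congr (_ - _).
  by rewrite /w !(smulDl, smulDr) !smulA -TZ.
- rewrite sqr_one_minus mul1m addrCA -[RHS]addr0; congr (_ + _).
  apply/eqP; rewrite subr_eq0 eq_sym subr_eq; apply/eqP.
  have e : Z ** Z + T ** Z ** (T ** Z) = T ** Z.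
    by rewrite -{3}ZT smulDl smulA -[T ** Z ** T]smulA -TZ smulA.
  rewrite /w !(smulDl, smulDr); set q := T ** Z ** (T ** Z) in e *.
  by rewrite -e !(addrACA (Z ** Z) q) (addrACA (Z ** Z + Z ** Z)).
- exact: opb1.
Qed.

Variables (T D : cstarAlgType R) (Phi : T -> D).
Hypothesis Phi_hom : is_starhom Phi.

Let Phi_lin : linear Phi := let: And3 h _ _ := Phi_hom in h.

(** The solution z of z + t^2 z = t lies in the domain, has norm at most 1/2, and
its image d' satisfies d - d' = d d d' where d = Phi t, so |d - d'| <= 1/2.  Both
norm bounds come from resolvent_bound, applied in the domain and in the target. *)
Lemma bounded_lift (t : T) : star t = t -> nrm (Phi t) <= 1 ->
  exists z, [/\ star z = z, nrm z <= 2^-1 & nrm (Phi t - Phi z) <= 2^-1].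
Proof.
have [_ PM Ps] := Phi_hom.
move=> st d1; have [z zt] := resolvent_exists st.
have half (V : completeNormedModType R[i]) (v : V) : nrm (v + v) <= 1 -> nrm v <= 2^-1.
  by rewrite -double2 nrmZr // => h; lra.
have [sz z1] := resolvent_bound st zt.
have sd : star (Phi t) = Phi t by rewrite -Ps st.
have dd : Phi z + Phi t ** Phi t ** Phi z = Phi t by rewrite -!PM -(linD Phi_lin) zt.
have [_ d'1] := resolvent_bound sd dd.
exists z; split=> //; first exact: half.
have -> : Phi t - Phi z = Phi t ** Phi t ** Phi z by rewrite -{1}dd addrC addKr.
apply: le_trans (nrmM _ _) _; apply: le_trans (ler_wpM2r (nrm_ge0 _) (nrmM _ _)) _.
have := half _ _ d'1; have := nrm_ge0 (Phi z); have := nrm_ge0 (Phi t); nra.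
Qed.

Hypothesis Phi_dense : closure (range Phi) = setT.

(** Density gives t with |d - Phi t| <= r/4, so that |Phi t| <= 5r/4, and bounded_lift at
scale 5r/4 leaves an error r/4 + 5r/8 = 7r/8. *)
Lemma approx_lift (d : D) r : star d = d -> 0 < r -> nrm d <= r ->
  exists z, [/\ star z = z, nrm z <= r & nrm (d - Phi z) <= 7 / 8 * r].
Proof.
have [_ PM Ps] := Phi_hom.
move=> sd r0 dr.
have r4 : 0 < r / 4 by rewrite divr_gt0.
have /closure_nrmP/(_ _ r4)[_ [t0 _ <-] dt0] : closure (range Phi) d by rewrite Phi_dense.
pose t := 2^-1%:C *: (t0 + star t0).
have st : star t = t by rewrite starZr starD starK addrC.
have dt : nrm (d - Phi t) <= r / 4.
  have -> : d - Phi t = 2^-1%:C *: ((d - Phi t0) + star (d - Phi t0)).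
    rewrite starB sd -Ps addrACA -opprD scalerBr scalerDr half_scale.
    by rewrite (linZ Phi_lin) (linD Phi_lin).
  rewrite nrmZr ?invr_ge0 //; have := nrmD (d - Phi t0) (star (d - Phi t0)).
  by rewrite nrm_star; lra.
pose s := 5 / 4 * r; have s0 : 0 < s by rewrite mulr_gt0 ?divr_gt0.
have si : 0 <= s^-1 by rewrite invr_ge0 ltW.
have ts : nrm (Phi t) <= s.
  by have := nrmB d (d - Phi t); rewrite subKr /s; lra.
have [||z [sz z2 zt]] := @bounded_lift (s^-1%:C *: t).
- by rewrite starZr st.
- by rewrite (linZ Phi_lin) nrmZr // ler_pdivrMl // mulr1.
have scale : Phi t - Phi (s%:C *: z) = s%:C *: (Phi (s^-1%:C *: t) - Phi z).
  rewrite scalerBr (linZ Phi_lin _ t) (linZ Phi_lin _ z) scalerA.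
  by rewrite -rmorphM /= mulfV ?gt_eqF // scale1r.
exists (s%:C *: z); split; first by rewrite starZr sz.
  by rewrite nrmZr ?(ltW s0) //; move: z2; rewrite /s; nra.
have := nrm_tri (Phi t) d (Phi (s%:C *: z)); rewrite scale nrmZr ?(ltW s0) //.
by move: zt dt; rewrite /s; nra.
Qed.

(** The range is closed because lifts can be chosen with controlled norm:
summing the successive corrections of approx_lift gives a convergent series. *)
Lemma dense_range_onto (d : D) : exists t, Phi t = d.
Proof.
have [_ PM Ps] := Phi_hom.
have sa_case (e : D) : star e = e -> exists t, Phi t = e.
  move=> se; pose r := nrm e + 1; have r0 : 0 < r by rewrite ltr_wpDl ?nrm_ge0.
  pose ok (p : D * R) z := star p.1 = p.1 -> 0 < p.2 -> nrm p.1 <= p.2 ->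
    [/\ star z = z, nrm z <= p.2 & nrm (p.1 - Phi z) <= 7 / 8 * p.2].
  have /choice[F hF] (p : D * R) : exists z, ok p z.
    have [[sp p0 pr]|np] := pselect [/\ star p.1 = p.1, 0 < p.2 & nrm p.1 <= p.2].
      by have [z zP] := approx_lift sp p0 pr; exists z.
    by exists 0 => sp p0 pr; case: np.
  pose q : R := 7 / 8; have q0 : 0 < q by rewrite divr_gt0.
  have q1 : q < 1 by rewrite /q; lra.
  pose u := fix u n := if n is n'.+1 then u n' + F (e - Phi (u n'), r * q ^+ n') else 0.
  have uP n : star (u n) = u n /\ nrm (e - Phi (u n)) <= r * q ^+ n.
    elim: n => [|n [su hu]].
      by rewrite /= stars0 (lin0 Phi_lin) subr0 expr0 mulr1 lerDl.
    have := hF (e - Phi (u n), r * q ^+ n); rewrite /ok /= starB se -Ps su.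
    move=> /(_ erefl (mulr_gt0 r0 (exprn_gt0 _ q0)) hu)[sz _ dz].
    rewrite starD su sz; split=> //; rewrite (linD Phi_lin) opprD addrA.
    by apply: le_trans dz _; rewrite exprS mulrCA.
  have [|l hl] := @geometric_complete T u q r (ltW q0) q1.
    move=> n; rewrite /= addrC addKr; have [su hu] := uP n.
    have := hF (e - Phi (u n), r * q ^+ n); rewrite /ok /= starB se -Ps su.
    by move=> /(_ erefl (mulr_gt0 r0 (exprn_gt0 _ q0)) hu)[].
  exists l; apply/esym/eqP; rewrite -subr_eq0; apply/eqP/nrm_eps0 => s s0.
  have s1 : 0 < s / 4 by rewrite divr_gt0.
  have s2 : 0 < s / 2 / r by rewrite !divr_gt0.
  have [N1 h1] := hl _ s1; have [N2 h2] := expr_small (ltW q0) q1 s2.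
  pose n := maxn N1 N2; have [_ un] := uP n.
  have := h1 n (leq_maxl _ _); have := h2 n (leq_maxr _ _).
  rewrite ler_pdivlMr // => qn ln.
  have := nrm_tri (Phi (u n)) e (Phi l); rewrite -[Phi (u n) - _](linB Phi_lin).
  have := starhom_bounded Phi_hom (u n - l); rewrite [nrm (u n - l)]nrm_distC.
  by lra.
pose re := 2^-1%:C *: (d + star d).
pose im := 2^-1%:C *: ('i%C *: (star d - d)).
have ic : conjc 'i%C = - 'i%C :> R[i] by apply/eqP; rewrite eq_complex /= oppr0 !eqxx.
have [|a ha] := sa_case re; first by rewrite starZr starD starK addrC.
have [|b hb] := sa_case im.
  by rewrite starZr starZc starB starK ic scaleNr -scalerN opprB.
exists (a + 'i%C *: b); rewrite (linD Phi_lin) (linZ Phi_lin) ha hb /re /im.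
have i2 : 'i%C * 'i%C = -1 :> R[i] by rewrite -expr2 sqr_i.
have -> : 'i%C *: (2^-1%:C *: ('i%C *: (star d - d))) = 2^-1%:C *: (d - star d).
  by rewrite !scalerA mulrAC i2 mulN1r scaleNr -scalerN opprB.
rewrite -scalerDr.
by rewrite addrACA subrr addr0 scalerDr half_scale.
Qed.

End DenseRange.

(** * Extension of bounded linear maps by density *)

Section Extension.
Variable R : realType.

Definition seminorm (X : lmodType R[i]) (N : X -> R) : Prop :=
  (forall x y, N (x + y) <= N x + N y) /\
  (forall k x, N (k *: x) <= nrm k * N x).

(** The linear span in X * V of a relation, that is, a linear map prescribed on
spanning vectors before it is known to be well defined. *)
Inductive linpair (X V : lmodType R[i]) (gen : X -> V -> Prop) : X -> V -> Prop :=
| linpair0 : linpair gen 0 0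
| linpair_gen x y : gen x y -> linpair gen x y
| linpair_lin k x y x' y' : linpair gen x y -> linpair gen x' y' ->
    linpair gen (k *: x + x') (k *: y + y').

Lemma lin_span_ind (X : lmodType R[i]) (A : set X) (Q : X -> Prop) :
  Q 0 -> (forall k v x, A v -> Q x -> Q (k *: v + x)) ->
  forall x, lin_span A x -> Q x.
Proof.
move=> Q0 QS x [n [k [v [Av ->]]]]; elim: n k v Av => [|n IH] k v Av.
  by rewrite big_ord0.
by rewrite big_ord_recl; apply: QS => //; apply: IH => i.
Qed.

Lemma lin_span0 (X : lmodType R[i]) (A : set X) : lin_span A 0.
Proof.
by exists 0%N, (fun=> 0), (fun=> 0); split; [case | rewrite big_ord0].
Qed.

Lemma lin_span_cons (X : lmodType R[i]) (A : set X) k v x :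
  A v -> lin_span A x -> lin_span A (k *: v + x).
Proof.
move=> Av [n [k' [v' [Av' ->]]]].
exists n.+1, (fun i => if unlift ord0 i is Some j then k' j else k),
  (fun i => if unlift ord0 i is Some j then v' j else v); split.
  by move=> i; case: unliftP.
rewrite big_ord_recl unlift_none; congr (_ + _).
by apply: eq_bigr => i _; rewrite liftK.
Qed.

Lemma lin_span_linpair (X V : lmodType R[i]) (gen : X -> V -> Prop) (A : set X) :
  (forall x, A x -> exists y, gen x y) ->
  forall x, lin_span A x -> exists y, linpair gen x y.
Proof.
move=> Ag; apply: lin_span_ind; first by exists 0; exact: linpair0.
move=> k v x /Ag[w vw] [y xy]; exists (k *: w + y).
by apply: linpair_lin => //; exact: linpair_gen.
Qed.

Definition dense_for (X : lmodType R[i]) (N : X -> R) (A : set X) : Prop :=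
  forall x e, 0 < e -> exists2 x', lin_span A x' & N (x - x') <= e.

Lemma nrm_seminorm (X : normedModType R[i]) : seminorm (fun x : X => nrm x).
Proof. by split=> [x y|k x]; [exact: nrmD | rewrite nrmZ]. Qed.

Lemma dense_nrm (X : normedModType R[i]) (A : set X) :
  closure (lin_span A) = setT -> dense_for (fun x : X => nrm x) A.
Proof.
by move=> cA x e e0; have /closure_nrmP/(_ _ e0) : closure (lin_span A) x by rewrite cA.
Qed.

Lemma dense_eq (X : lmodType R[i]) (N : X -> R) (A : set X)
    (V : normedModType R[i]) (F G : X -> V) (C : R) :
  0 <= C -> dense_for N A -> linear F -> linear G ->
  (forall x, nrm (F x) <= C * N x) -> (forall x, nrm (G x) <= C * N x) ->
  (forall x, A x -> F x = G x) -> forall x, F x = G x.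
Proof.
move=> C0 dA lF lG bF bG FG x; apply/eqP; rewrite -subr_eq0; apply/eqP/nrm_eps0 => e e0.
have c0 : 0 < C + C + 1 by rewrite ltr_wpDl ?addr_ge0.
have [x' sx' xx'] := dA x _ (divr_gt0 e0 c0).
have FG' : F x' = G x'.
  elim/lin_span_ind: sx' => [|k v y Av FGy]; first by rewrite (lin0 lF) (lin0 lG).
  by rewrite lF lG FG // FGy.
have -> : F x - G x = F (x - x') - G (x - x').
  by rewrite (linB lF) (linB lG) FG' opprB subrKA.
apply: le_trans (nrmB _ _) _.
apply: le_trans (lerD (bF _) (bG _)) _.
apply: le_trans (lerD (ler_wpM2l C0 xx') (ler_wpM2l C0 xx')) _.
rewrite -mulrDl mulrA ler_pdivrMr // mulrC ler_wpM2l ?(ltW e0) //.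
by rewrite lerDl.
Qed.

(** The bound makes the span of [gen] single-valued and sends Cauchy sequences to
Cauchy sequences, so its closure is the graph of a map defined everywhere.  A
seminorm rather than a norm on the source, so that c_0 can be used without a
topology. *)
Lemma bounded_extension (X : lmodType R[i]) (N : X -> R)
    (V : completeNormedModType R[i]) (gen : X -> V -> Prop) (C : R) :
  seminorm N -> 0 <= C ->
  (forall x y, linpair gen x y -> nrm y <= C * N x) ->
  dense_for N [set x | exists y, gen x y] ->
  exists f : X -> V, [/\ linear f, forall x y, gen x y -> f x = y
    & forall x, nrm (f x) <= C * N x].
Proof.
move=> [ND NZ] C0 bg dg.
have dg' x e : 0 < e -> exists p : X * V, linpair gen p.1 p.2 /\ N (x - p.1) <= e.
  move=> /(dg x)[x' sx' xx']; have [//|y xy] := @lin_span_linpair _ _ gen _ _ _ sx'.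
  by exists (x', y).
have NN x : N (- x) <= N x.
  by rewrite -scaleN1r; apply: le_trans (NZ _ _) _; rewrite /nrm normrN1 mul1r.
have N0 : N 0 = 0.
  have := ND 0 0; have := NZ 0 0; rewrite addr0 scale0r nrm0 mul0r; lra.
have NB x y : N (x - y) <= N x + N y.
  by apply: le_trans (ND _ _) _; rewrite lerD2l.
pose rel x y := forall e, 0 < e -> exists x' y',
  [/\ linpair gen x' y', N (x - x') <= e & nrm (y - y') <= e].
have rel_lin k x y x2 y2 : rel x y -> rel x2 y2 -> rel (k *: x + x2) (k *: y + y2).
  move=> xy xy2 e e0; have k1 : 0 < nrm k + 1 by rewrite ltr_wpDl ?nrm_ge0.
  have [a [b [ab xa yb]]] := xy _ (divr_gt0 e0 k1).
  have [c [d [cd xc yd]]] := xy2 _ (divr_gt0 e0 k1).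
  have le_e u v : u <= e / (nrm k + 1) -> v <= e / (nrm k + 1) -> nrm k * u + v <= e.
    rewrite !ler_pdivlMr //; have := nrm_ge0 k; nra.
  exists (k *: a + c), (k *: b + d); split; first exact: linpair_lin.
    rewrite opprD addrACA -scalerBr; apply: le_trans (ND _ _) _.
    by apply: le_trans (le_e _ _ xa xc); rewrite lerD2r.
  rewrite opprD addrACA -scalerBr; apply: le_trans (nrmD _ _) _.
  by rewrite nrmZ; exact: le_e.
have rel_bound x y : rel x y -> nrm y <= C * N x.
  move=> xy; apply/ler_addgt0Pr => e e0; have C1 : 0 < C + 1 by rewrite ltr_wpDl.
  have [a [b [ab xa yb]]] := xy _ (divr_gt0 e0 C1).
  have := nrmD (y - b) b; rewrite subrK; have := bg _ _ ab.
  have := NB x (x - a); rewrite subKr; move: xa yb; rewrite !ler_pdivlMr //.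
  nra.
have rel_ex x : exists y, rel x y.
  pose q : R := 2^-1; have q0 : 0 < q by rewrite invr_gt0.
  have q1 : q < 1 by rewrite invf_lt1 ?ltr1n.
  have [p pP] := choice (fun n => dg' x _ (exprn_gt0 n q0)).
  have pd n m : nrm ((p n).2 - (p m).2) <= C * (q ^+ n + q ^+ m).
    have [gn xn] := pP n; have [gm xm] := pP m.
    have := linpair_lin (-1) gm gn; rewrite !scaleN1r ![- _ + _]addrC => /bg/le_trans; apply.
    rewrite ler_wpM2l //; have -> : (p n).1 - (p m).1 = (x - (p m).1) - (x - (p n).1).
      by rewrite opprB [RHS]addrC subrKA.
    by apply: le_trans (NB _ _) _; rewrite addrC lerD.
  have C1 : 0 < C + 1 by rewrite ltr_wpDl.
  have [|y yP] := @nrm_complete R V (fun n => (p n).2).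
    move=> e e0; have e2 : 0 < e / 2 / (C + 1) by rewrite !divr_gt0.
    have [K hK] := expr_small (ltW q0) q1 e2.
    exists K => n m /hK qn /hK qm; apply: le_trans (pd n m) _.
    move: qn qm; rewrite !ler_pdivlMr //.
    have := exprn_ge0 n (ltW q0); have := exprn_ge0 m (ltW q0); nra.
  exists y => e e0; have [K1 h1] := yP _ e0; have [K2 h2] := expr_small (ltW q0) q1 e0.
  pose n := maxn K1 K2; have [gn xn] := pP n.
  exists (p n).1, (p n).2; split=> //; last exact/h1/leq_maxl.
  by apply: le_trans xn _; apply/h2/leq_maxr.
have [f fP] := choice rel_ex.
have rel_fun x y y' : rel x y -> rel x y' -> y = y'.
  move=> xy xy'; have := rel_bound _ _ (rel_lin (-1) _ _ _ _ xy xy').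
  rewrite !scaleN1r addNr N0 mulr0 => h; apply/eqP; rewrite eq_sym -subr_eq0 addrC.
  by rewrite -nrm_eq0; apply/eqP/le_anti; rewrite h nrm_ge0.
exists f; split.
- move=> k x y; apply: rel_fun (fP _) _; exact: rel_lin.
- move=> x y xy; apply: rel_fun (fP _) _ => e e0; exists x, y.
  by rewrite !subrr N0 nrm0 (ltW e0); split=> //; exact: linpair_gen.
- by move=> x; exact: rel_bound.
Qed.

(** Multipliers are continuous for the topology tested by c m(d) = m(c) d with c
in D, so no bound on [m] or [n] is required. *)
Lemma nondegenerate_eq (I : Type) (D : cstarAlgType R) (f : I -> multiplier D)
    (m n : multiplier D) : Defs.nondegenerate f -> (forall a, m ** f a = n ** f a) -> m = n.
Proof.
move=> f_nd mn; apply: multiplier_eql => d; apply: smul_injl => c.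
rewrite !mult_assoc.
apply: (@dense_eq D _ _ D (fun d => rmult m c ** d) (fun d => rmult n c ** d)
          (nrm (rmult m c) + nrm (rmult n c))
          (addr_ge0 (nrm_ge0 _) (nrm_ge0 _)) (dense_nrm f_nd)).
- by move=> k z w; rewrite smulDr smulZr.
- by move=> k z w; rewrite smulDr smulZr.
- move=> z; apply: le_trans (nrmM _ _) _; rewrite ler_wpM2r ?nrm_ge0 //.
  by rewrite lerDl nrm_ge0.
- move=> z; apply: le_trans (nrmM _ _) _; rewrite ler_wpM2r ?nrm_ge0 //.
  by rewrite lerDr nrm_ge0.
- move=> x [a [e ->]]; by rewrite -!mult_assoc -!lmultMl mn.
Qed.

Section UnitaryExtension.
Variables (A D : cstarAlgType R) (f : A -> multiplier D).
Hypotheses (f_hom : is_starhom f) (f_nd : Defs.nondegenerate f).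

Let gen (u : multiplier A) (x y : D) : Prop :=
  exists a d, x = lmult (f a) d /\ y = lmult (f (lmult u a)) d.

Lemma gen_adjoint u x y c c' : linpair (gen u) x y -> linpair (gen (star u)) c c' ->
  star c' ** x = star c ** y.
Proof.
have [_ fM fs] := f_hom.
elim=> [|{}x {}y xy|k {}x {}y x2 y2 _ IH1 _ IH2] cc; first by rewrite !smulr0.
  elim: cc => [|{}c {}c' [b [d' [-> ->]]]|k {}c {}c' c2 c2' _ IH1 _ IH2].
  - by rewrite !stars0 !mul0s.
  - have [a [d [-> ->]]] := xy.
    rewrite !lmult_adj -!lmultMl -!fs -!fM; congr (_ ** lmult (f _) d).
    by rewrite lmult_adj starK.
  - by rewrite !starD !starZc !smulDl !smulZl IH1 IH2.
by rewrite !smulDr !smulZr IH1 // IH2.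
Qed.

(** When u is unitary the transposed pairs belong to the span for u*, so
gen_adjoint compares the inner squares of x and y. *)
Lemma gen_isometric u x y : star u ** u = mult_one -> linpair (gen u) x y ->
  nrm y = nrm x.
Proof.
move=> uu xy; have yx : linpair (gen (star u)) y x.
  elim: xy => [|{}x {}y [a [d [-> ->]]]|k x1 y1 x2 y2 _ IH1 _ IH2].
  - exact: linpair0.
  - apply: linpair_gen; exists (lmult u a), d; split=> //.
    by rewrite -lmultMl uu.
  - exact: linpair_lin.
apply/eqP; rewrite -(@eqrXn2 _ 2) ?nrm_ge0 //; apply/eqP.
by rewrite -!nrm_cstar (gen_adjoint xy yx).
Qed.

(** On the dense span of the vectors f(a)d the extension of u must be
f(a)d |-> f(ua)d, which is well defined and isometric since u is unitary. *)
Lemma unitary_extension u : star u ** u = mult_one -> u ** star u = mult_one ->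
  exists2 n : multiplier D, opb n 1 & forall a, n ** f a = f (lmult u a).
Proof.
move=> u1 u2; pose S : set D := [set x | exists a d, x = lmult (f a) d].
have dS : dense_for (fun d : D => nrm d) S := dense_nrm f_nd.
have ext v : star v ** v = mult_one -> exists V : D -> D,
    [/\ linear V, forall a d, V (lmult (f a) d) = lmult (f (lmult v a)) d
      & forall x, nrm (V x) <= 1 * nrm x].
  move=> v1; have [|||V [Vl Vg Vb]] := @bounded_extension D _ D (gen v) 1 (@nrm_seminorm D).
  - exact: ler01.
  - by move=> x y /(gen_isometric v1) ->; rewrite mul1r.
  - move=> x e /(dS x)[x' sx' xx']; exists x' => //.
    elim/lin_span_ind: sx' {xx'} => [|k w y [a [d ->]] IH]; first exact: lin_span0.
    by apply: lin_span_cons => //; exists (lmult (f (lmult v a)) d), a, d.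
  - by exists V; split=> // a d; apply: Vg; exists a, d.
have [V [Vl Vg Vb]] := ext u u1.
have [W [Wl Wg Wb]] := ext (star u) (etrans (congr1 (fun m => m ** _) (starK u)) u2).
have VW x c : star (W c) ** x = star c ** V x.
  have lefts (a b : D) : linear (fun x : D => a ** x) by move=> k y z; rewrite smulDr smulZr.
  have VWg c0 (Sc : S c0) y : star (W c0) ** y = star c0 ** V y.
    apply: (@dense_eq D _ S D (fun y => star (W c0) ** y) (fun y => star c0 ** V y)
              (nrm (W c0) + nrm c0) (addr_ge0 (nrm_ge0 _) (nrm_ge0 _)) dS) => //.
    - exact: lefts.
    - by move=> k z w; rewrite Vl smulDr smulZr.
    - move=> z; apply: le_trans (nrmM _ _) _; rewrite nrm_star ler_wpM2r ?nrm_ge0 //.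
      by rewrite lerDl nrm_ge0.
    - move=> z; apply: le_trans (nrmM _ _) _; rewrite nrm_star.
      have := Vb z; have := nrm_ge0 c0; have := nrm_ge0 (W c0); have := nrm_ge0 z; nra.
    - move=> z [a [d ->]]; have [b [d' ->]] := Sc; rewrite Wg Vg.
      by apply: (@gen_adjoint u); apply: linpair_gen; [exists a, d | exists b, d'].
  rewrite -[LHS]starK -[RHS]starK; congr star; rewrite !starM !starK.
  apply: (@dense_eq D _ S D (fun c => star x ** W c) (fun c => star (V x) ** c)
            (nrm x + nrm (V x)) (addr_ge0 (nrm_ge0 _) (nrm_ge0 _)) dS) => //.
  - by move=> k z w; rewrite Wl smulDr smulZr.
  - exact: lefts.
  - move=> z; apply: le_trans (nrmM _ _) _; rewrite nrm_star.
    have := Wb z; have := nrm_ge0 x; have := nrm_ge0 (V x); have := nrm_ge0 z; nra.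
  - move=> z; apply: le_trans (nrmM _ _) _; rewrite nrm_star ler_wpM2r ?nrm_ge0 //.
    by rewrite lerDr nrm_ge0.
  - by move=> z Sz; rewrite -[LHS]starK -[RHS]starK; congr star; rewrite !starM !starK VWg.
have nP (a b : D) : a ** V b = star (W (star a)) ** b by rewrite VW starK.
exists (Multiplier nP) => [|a]; first by split.
by apply: multiplier_eql => d; rewrite lmultMl; exact: Vg.
Qed.

End UnitaryExtension.

End Extension.

(** * Toeplitz families *)

Section ToeplitzFamily.
Variables (R : realType) (E : digraph) (D : cstarAlgType R).
Variables (P : vertex E -> D) (S : edge E -> D).
Hypothesis PS_family : is_toeplitz_family P S.

Lemma proj_star v : star (P v) = P v.
Proof. by case: PS_family => h *; case: (h v). Qed.

Lemma proj_idem v : P v ** P v = P v.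
Proof. by case: PS_family => h *; case: (h v). Qed.

Lemma proj_mul v w : P v ** P w = (v == w)%:R *: P v.
Proof.
case: PS_family => _ h _ _ _; case: eqVneq => [<-|/eqP/h ->].
  by rewrite scale1r proj_idem.
by rewrite scale0r.
Qed.

Lemma isom_initial e : star (S e) ** S e = P (src e).
Proof. by case: PS_family. Qed.

Lemma isom_src e : S e ** P (src e) = S e.
Proof. by rewrite -isom_initial smulA; case: PS_family. Qed.

(** From P - S S* = c*c one gets x x* + y*y = 0 for x = (1 - P)S and
y = c(1 - P). *)
Lemma proj_rng e : P (rng e) ** S e = S e.
Proof.
have [_ _ _ _ /(_ (rng e) [fset e]%fset)[|c]] := PS_family.
  by move=> f; rewrite inE => /eqP ->.
rewrite big_seq_fset1 => /eqP; rewrite subr_eq => /eqP Pc.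
pose K : multiplier D := mult_one - to_mult (P (rng e)).
have sK : star K = K by rewrite starB star_one -to_mult_star proj_star.
have PK : to_mult (P (rng e)) ** K = 0.
  by rewrite smulBr mulm1 -to_multM proj_idem subrr.
have : rmult K (star (S e)) = 0.
  apply: (@sum_squares_eq0 _ _ _ (rmult K c)); apply: to_mult_inj.
  rewrite to_multD !to_multM !to_mult_star -!rmult_to_mult !starM -!to_mult_star starK sK.
  rewrite !smulA -[K ** _ ** _]smulA -[K ** _ ** to_mult c]smulA -smulDl -smulDr.
  by rewrite -!to_multM -to_multD addrC -Pc -smulA PK muls0 to_mult0.
move=> /(congr1 (@star _ _)) /=; rewrite stars0 starB starM !starK proj_star.
by move/eqP; rewrite subr_eq0 => /eqP <-.
Qed.

(** If P - S_e S_e* - S_f S_f* = c*c, then compressing by S_e leaves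
S_e* S_f S_f* S_e + (c S_e)* (c S_e) = 0. *)
Lemma isom_orth e f : e != f -> star (S e) ** S f = 0.
Proof.
move=> ef; have [rr|rr] := eqVneq (rng e) (rng f); last first.
  rewrite -(proj_rng e) -(proj_rng f) starM proj_star -smulA [P _ ** (_ ** _)]smulA.
  by rewrite proj_mul (negbTE rr) scale0r smul0r smulr0.
have [_ _ _ _ /(_ (rng e) [fset e; f]%fset)[|c]] := PS_family.
  by move=> d; rewrite !inE => /orP[] /eqP ->.
rewrite big_fsetU1 ?inE //= big_seq_fset1 => /eqP; rewrite subr_eq => /eqP Pc.
suff : star (S f) ** S e = 0.
  by move=> /(congr1 (@star _ _)); rewrite starM starK star0.
apply: (@sum_squares_eq0 _ _ _ (c ** S e)).
rewrite !starM starK.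
have -> : star (S e) ** S f ** (star (S f) ** S e) + star (S e) ** star c ** (c ** S e)
   = star (S e) ** (star c ** c + S f ** star (S f)) ** S e.
  by rewrite smulDr smulDl !smulA addrC.
have -> : star c ** c + S f ** star (S f) = P (rng e) - S e ** star (S e).
  by rewrite Pc [S e ** _ + _]addrC addrA addrK.
by rewrite smulBr smulBl -!smulA proj_rng isom_initial isom_src isom_initial subrr.
Qed.

End ToeplitzFamily.

(** * Families of orthogonal projections represent c_0 *)

Section C0Norm.
Variables (R : realType) (X : choiceType).
Implicit Types a b : c0 R X.

Lemma c0_bounded a : exists M : R, forall v, nrm (a v) <= M.
Proof.
have /finite_seqP[s sE] := @c0P _ _ a 1 ltr01.
exists (1 + \sum_(v <- s) nrm (a v)) => v.
have sum0 (t : seq X) : 0 <= \sum_(v <- t) nrm (a v) by apply: sumr_ge0 => i _; exact: nrm_ge0.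
have [vs|vs] := boolP (v \in s).
  rewrite (big_rem v) //= addrCA lerDl addr_ge0 //; exact: sum0.
have : ~ [set v | 1 <= `|a v|] v by rewrite sE /=; apply/negP.
rewrite /= normE -(rmorph1 (real_complex R)) lecR => /negP; rewrite -ltNge => /ltW /le_trans; apply.
by rewrite lerDl sum0.
Qed.

Definition c0norm a : R := sup [set r | r = 0 \/ exists v, r = nrm (a v)].

Let c0_has_sup a : has_sup [set r : R | r = 0 \/ exists v, r = nrm (a v)].
Proof.
split; first by exists 0; left.
have [M hM] := c0_bounded a; exists `|M| => r [->|[v ->]]; first exact: normr_ge0.
by apply: le_trans (hM v) _; exact: ler_norm.
Qed.

Lemma nrm_le_c0norm a v : nrm (a v) <= c0norm a.
Proof. by apply: ub_le_sup; [exact: (c0_has_sup a).2 | right; exists v]. Qed.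

Lemma c0norm_ge0 a : 0 <= c0norm a.
Proof. by apply: ub_le_sup; [exact: (c0_has_sup a).2 | left]. Qed.

Lemma c0norm_le a r : 0 <= r -> (forall v, nrm (a v) <= r) -> c0norm a <= r.
Proof.
move=> r0 h; apply: ge_sup; first exact: (c0_has_sup a).1.
by move=> s [->|[v ->]].
Qed.

Lemma c0norm_seminorm : seminorm c0norm.
Proof.
split=> [a b|k a]; apply: c0norm_le.
- by rewrite addr_ge0 ?c0norm_ge0.
- by move=> v; apply: le_trans (nrmD _ _) _; rewrite lerD ?nrm_le_c0norm.
- by rewrite mulr_ge0 ?nrm_ge0 ?c0norm_ge0.
- by move=> v; rewrite nrmCM ler_wpM2l ?nrm_ge0 ?nrm_le_c0norm.
Qed.

Lemma c0normM a b : c0norm (a ** b) <= c0norm a * c0norm b.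
Proof.
apply: c0norm_le => [|v]; first by rewrite mulr_ge0 ?c0norm_ge0.
by rewrite nrmCM ler_pM ?nrm_ge0 ?nrm_le_c0norm.
Qed.

Lemma c0norm_star a : c0norm (star a) <= c0norm a.
Proof.
by apply: c0norm_le => [|v]; rewrite ?c0norm_ge0 // nrm_conj nrm_le_c0norm.
Qed.

Lemma c0_delta_mul a (v : X) : a ** c0_delta R v = a v *: c0_delta R v.
Proof.
by apply: c0_eq => x /=; case: eqVneq => [->|]; rewrite ?mulr1 ?mulr0.
Qed.

Lemma c0_delta_star (v : X) : star (c0_delta R v) = c0_delta R v.
Proof. by apply: c0_eq => x /=; rewrite conjc_nat. Qed.

Lemma c0_dense : dense_for c0norm [set a | exists v : X, a = c0_delta R v].
Proof.
move=> a e e0; have e0' : 0 < e%:C by rewrite ltcR.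
have /finite_seqP[s sE] := c0P a e0'.
pose x := \sum_(v <- undup s) a v *: c0_delta R v.
have xE w : c0_fun x w = if w \in undup s then a w else 0.
  rewrite /x; elim: (undup s) (undup_uniq s) => [|v t IH] /=.
    by rewrite big_nil.
  move=> /andP[vt /IH{}IH]; rewrite big_cons /= IH in_cons.
  case: eqVneq => [->|_] /=; last by rewrite mulr0 add0r.
  by rewrite (negbTE vt) mulr1 addr0.
exists x.
  rewrite /x; elim: (undup s) => [|v t IH]; first by rewrite big_nil; exact: lin_span0.
  by rewrite big_cons; apply: lin_span_cons => //; exists v.
apply: c0norm_le => [|v]; first exact: ltW.
have -> : (a - x : c0 R X) v = a v - c0_fun x v by [].
rewrite xE mem_undup; case: ifPn => vs; first by rewrite subrr nrm0 ltW.
rewrite subr0; have : ~ [set v | e%:C <= `|a v|] v by rewrite sE /=; apply/negP.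
by rewrite /= normE lecR => /negP; rewrite -ltNge => /ltW.
Qed.

End C0Norm.

Section OrthogonalProjections.
Variables (R : realType) (X : choiceType) (D : cstarAlgType R) (P : X -> D).
Hypothesis Pstar : forall v, star (P v) = P v.
Hypothesis Pmul : forall v w, P v ** P w = (v == w)%:R *: P v.

Definition proj_sum (s : seq X) (k : X -> R[i]) : D := \sum_(v <- s) k v *: P v.

Lemma proj_sum_star s k : star (proj_sum s k) = proj_sum s (fun v => conjc (k v)).
Proof.
rewrite /proj_sum; elim: s => [|v s IH]; first by rewrite !big_nil stars0.
by rewrite !big_cons starD starZc Pstar IH.
Qed.

Lemma proj_sumMl s k v : uniq s ->
  P v ** proj_sum s k = (if v \in s then k v else 0) *: P v.
Proof.
rewrite /proj_sum; elim: s => [|w s IH] /=.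
  by rewrite big_nil muls0 scale0r.
move=> /andP[ws /IH{}IH]; rewrite big_cons smulDr IH smulZr Pmul in_cons.
case: eqVneq => [->|_] /=; first by rewrite (negbTE ws) scale0r addr0 scale1r.
by rewrite scale0r scaler0 add0r.
Qed.

Lemma proj_sumM s k l : uniq s ->
  proj_sum s k ** proj_sum s l = proj_sum s (fun v => k v * l v).
Proof.
move=> us; rewrite {1 3}/proj_sum.
have : {subset s <= s} by [].
elim: {1 3 5}s => [|v t IH] ts; first by rewrite !big_nil mul0s.
rewrite !big_cons smulDl smulZl proj_sumMl // ts ?mem_head // scalerA.
by rewrite IH // => w wt; apply: ts; rewrite in_cons wt orbT.
Qed.

Lemma proj_sum_lin s c k l :
  proj_sum s (fun v => c * k v + l v) = c *: proj_sum s k + proj_sum s l.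
Proof.
rewrite /proj_sum scaler_sumr -big_split /=; apply: eq_bigr => v _.
by rewrite scalerDl scalerA.
Qed.

(** The sum of the k_v P_v commutes with 1 - W, where W is the sum of the
(1 - sqrt(1 - k_v^2)) P_v, and their squares add up to 1. *)
Lemma proj_sum_real_bound s (k : X -> R) : uniq s -> (forall v, `|k v| <= 1) ->
  nrm (proj_sum s (fun v => (k v)%:C)) <= 1.
Proof.
move=> us k1; set G := proj_sum s _.
have real_star (l : X -> R) : star (proj_sum s (fun v => (l v)%:C)) = proj_sum s (fun v => (l v)%:C).
  by rewrite proj_sum_star; apply: eq_bigr => v _; rewrite conjc_real.
pose w v := 1 - Num.sqrt (1 - k v ^+ 2).
pose W := proj_sum s (fun v => (w v)%:C).
apply: nrm_opb; apply: (@mult_orth_part _ _ _ (mult_one - to_mult W) mult_one 1).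
- by rewrite -to_mult_star real_star.
- by rewrite starB star_one -to_mult_star real_star.
- exact: star_one.
- rewrite smulBl smulBr mul1m mulm1 -!to_multM !proj_sumM //.
  by congr (_ - to_mult _); apply: eq_bigr => v _; rewrite mulrC.
- rewrite sqr_one_minus mul1m -!to_multM -to_multD !proj_sumM //.
  rewrite -to_multN -to_multD; set Z := W + W - _.
  have -> : proj_sum s (fun v => (k v)%:C * (k v)%:C) = Z.
    rewrite /Z /W /proj_sum -sumrN -!big_split /=; apply: eq_bigr => v _.
    rewrite -scaleNr -!scalerDl -!rmorphM -rmorphN -!rmorphD /=.
    have : 0 <= 1 - k v ^+ 2.
      by rewrite subr_ge0 -real_normK ?num_real // expr_le1.
    move=> /sqr_sqrtr; rewrite /w; set q := Num.sqrt _ => qq.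
    by congr (_%:C *: _); rewrite -expr2; move: qq; rewrite expr2; lra.
  by rewrite addrC subrK.
- exact: opb1.
Qed.

Lemma proj_sum_bound s (k : X -> R[i]) r : uniq s -> 0 <= r ->
  (forall v, nrm (k v) <= r) -> nrm (proj_sum s k) <= r.
Proof.
move=> us; wlog r1 : k r / r = 1.
  move=> wl r0 kr; have [r00|r_neq0] := eqVneq r 0.
    suff -> : proj_sum s k = 0 by rewrite nrm0.
    rewrite /proj_sum big1 // => v _.
    have /eqP : nrm (k v) = 0 by apply/le_anti; rewrite nrm_ge0 -{1}r00 kr.
    by rewrite nrm_eq0 => /eqP ->; rewrite scale0r.
  have rp : 0 < r by rewrite lt_def r_neq0.
  have := wl (fun v => r^-1%:C * k v) 1 erefl ler01 _.
  have -> : proj_sum s (fun v => r^-1%:C * k v) = r^-1%:C *: proj_sum s k.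
    by rewrite /proj_sum scaler_sumr; apply: eq_bigr => v _; rewrite scalerA.
  rewrite nrmZr ?invr_ge0 // ler_pdivrMl // mulr1; apply=> v.
  by rewrite nrmCM nrmC ger0_norm ?invr_ge0 // ler_pdivrMl // mulr1.
rewrite r1 => _ k1.
rewrite -(@ler_pXn2r _ 2) ?nnegrE ?nrm_ge0 // expr1n -nrm_cstar.
rewrite proj_sum_star proj_sumM //.
have -> : proj_sum s (fun v => conjc (k v) * k v) = proj_sum s (fun v => (nrm (k v) ^+ 2)%:C).
  by apply: eq_bigr => v _; rewrite mulrC -sqr_normc normE rmorphXn.
apply: proj_sum_real_bound => // v.
rewrite ger0_norm ?exprn_ge0 ?nrm_ge0 // expr_le1 ?nrm_ge0 //; exact: k1.
Qed.

Let gen (a : c0 R X) (y : D) : Prop := exists v, a = c0_delta R v /\ y = P v.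

(** Large index sets [t] are allowed so that two pairs can be compared over a
common one. *)
Lemma linpair_proj_sum a y : linpair gen a y ->
  exists s : seq X, forall t, uniq t -> {subset s <= t} -> y = proj_sum t a.
Proof.
elim=> [|{}a {}y [v [-> ->]]|k {}a {}y a2 y2 _ [s IH1] _ [s2 IH2]].
- by exists [::] => t _ _; rewrite /proj_sum big1 // => v _; rewrite scale0r.
- exists [:: v] => t ut vt; rewrite /proj_sum (bigD1_seq v) //=; last by rewrite vt ?mem_head.
  by rewrite eqxx scale1r big1 ?addr0 // => w /negbTE ->; rewrite scale0r.
- exists (s ++ s2) => t ut st; rewrite (IH1 t) ?(IH2 t) //.
  + by rewrite -proj_sum_lin.
  + by move=> v vs; apply: st; rewrite mem_cat vs orbT.
  + by move=> v vs; apply: st; rewrite mem_cat vs.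
Qed.

Lemma c0_representation : exists f : c0 R X -> D,
  [/\ is_starhom f, forall v, f (c0_delta R v) = P v,
      forall a v, f a ** P v = a v *: P v & forall a, nrm (f a) <= c0norm a].
Proof.
have [|||f [fl fg fb]] := @bounded_extension R _ (@c0norm R X) D gen 1 (@c0norm_seminorm R X).
- exact: ler01.
- move=> a y /linpair_proj_sum[s /(_ (undup s) (undup_uniq s))-> //].
    by rewrite mul1r; apply: proj_sum_bound; rewrite ?undup_uniq ?c0norm_ge0 //; exact: nrm_le_c0norm.
  by move=> v; rewrite mem_undup.
- move=> a e e0; have [a' sa aa] := c0_dense a e0; exists a' => //.
  elim/lin_span_ind: sa {aa} => [|k v x [w ->] IH]; first exact: lin_span0.
  by apply: lin_span_cons => //; exists (P w), w.
have fd v : f (c0_delta R v) = P v by apply: fg; exists v.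
have fb' a : nrm (f a) <= c0norm a by rewrite -[leRHS]mul1r.
have fP a v : f a ** P v = a v *: P v.
  apply: (dense_eq (F := fun a => f a ** P v) (G := fun a => (a : c0 R X) v *: P v)
    (nrm_ge0 (P v)) (@c0_dense R X)).
  - by move=> k x y; rewrite fl smulDl smulZl.
  - by move=> k x y; rewrite /= scalerDl scalerA.
  - by move=> x; rewrite mulrC; apply: le_trans (nrmM _ _) _; rewrite ler_wpM2r ?nrm_ge0.
  - by move=> x; rewrite nrmZ mulrC ler_wpM2l ?nrm_ge0 ?nrm_le_c0norm.
  - by move=> x [w ->]; rewrite fd Pmul /= eq_sym; case: eqVneq => [->|]; rewrite ?scale0r.
exists f; split=> //; split=> //.
- move=> a; apply: (dense_eq (F := fun b => f (a ** b)) (G := fun b => f a ** f b)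
    (c0norm_ge0 a) (@c0_dense R X)).
  + by move=> k x y; rewrite smulDr smulZr fl.
  + by move=> k x y; rewrite fl smulDr smulZr.
  + by move=> x; apply: le_trans (fb' _) _; exact: c0normM.
  + move=> x; apply: le_trans (nrmM _ _) _.
    by rewrite ler_pM ?nrm_ge0.
  + by move=> x [v ->]; rewrite c0_delta_mul (linZ fl) fd fP.
- move=> a; rewrite -[LHS]starK; congr star; move: a.
  apply: (dense_eq (F := fun b => star (f (star b))) ler01 (@c0_dense R X)) => //.
  + by move=> k x y; rewrite starD starZc fl starD starZc conjcK.
  + by move=> x; rewrite mul1r nrm_star; apply: le_trans (fb' _) _; exact: c0norm_star.
  + by move=> x [v ->]; rewrite c0_delta_star fd Pstar.
Qed.

End OrthogonalProjections.

(** * Nondegeneracy and extension to multiplier algebras *)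

Section Nondegeneracy.
Variable R : realType.

Lemma cstar_generated_ind (D : cstarAlgType R) (A N : set D) :
  cstar_generated A = setT -> is_cstar_subalg N -> (forall x, A x -> N x) ->
  forall x, N x.
Proof.
move=> AT Nsub AN x.
have : cstar_generated A `<=` N by apply: smallest_sub.
by rewrite AT => /(_ x I).
Qed.

Definition closed_subspace (V : normedModType R[i]) (W : set V) : Prop :=
  [/\ W 0, forall k x y, W x -> W y -> W (k *: x + y)
    & forall x, (forall e : R, 0 < e -> exists2 y, W y & nrm (x - y) <= e) -> W x].

Lemma lin_span_add (V : lmodType R[i]) (A : set V) k x y :
  lin_span A x -> lin_span A y -> lin_span A (k *: x + y).
Proof.
move=> + Ay; elim/lin_span_ind => [|l v z Av IH]; first by rewrite scaler0 add0r.
by rewrite scalerDr scalerA -addrA; exact: lin_span_cons.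
Qed.

Lemma lin_span1 (V : lmodType R[i]) (A : set V) x : A x -> lin_span A x.
Proof.
by move=> Ax; have := lin_span_cons 1 Ax (lin_span0 A); rewrite scale1r addr0.
Qed.

Lemma closure_span_subspace (V : normedModType R[i]) (A : set V) :
  closed_subspace (closure (lin_span A)).
Proof.
split.
- by apply: subset_closure; exact: lin_span0.
- move=> k x y /closure_nrmP hx /closure_nrmP hy; apply/closure_nrmP => e e0.
  have k1 : 0 < nrm k + 1 by rewrite ltr_wpDl ?nrm_ge0.
  have [x' Ax xx] := hx _ (divr_gt0 e0 k1); have [y' Ay yy] := hy _ (divr_gt0 e0 k1).
  exists (k *: x' + y'); first exact: lin_span_add.
  rewrite opprD addrACA -scalerBr; apply: le_trans (nrmD _ _) _.
  rewrite nrmZ; move: xx yy; rewrite !ler_pdivlMr //.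
  have := nrm_ge0 k; nra.
- move=> x h; apply/closure_nrmP => e e0; have e2 : 0 < e / 2 by rewrite divr_gt0.
  have [y /closure_nrmP/(_ _ e2)[z Az yz] xy] := h _ e2.
  by exists z => //; have := nrm_tri y x z; lra.
Qed.

Lemma closed_subspace_dense (V : normedModType R[i]) (A W : set V) :
  closure (lin_span A) = setT -> closed_subspace W -> (forall x, A x -> W x) ->
  forall x, W x.
Proof.
move=> AT [W0 WD Wc] AW x; apply: Wc => e e0.
have [y Ay xy] := dense_nrm AT x e0; exists y => //.
by elim/lin_span_ind: Ay {xy} => // k v z /AW; exact: WD.
Qed.

Lemma closed_subspace_preim (V V' : normedModType R[i]) (W : set V') (f : V -> V') C :
  linear f -> (forall x, nrm (f x) <= C * nrm x) -> closed_subspace W ->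
  closed_subspace [set x | W (f x)].
Proof.
move=> fl fb [W0 WD Wc]; split=> [|k x y Wx Wy|x h] /=.
- by rewrite (lin0 fl).
- by rewrite fl; exact: WD.
- apply: Wc => e e0; have C1 : 0 < `|C| + 1 by rewrite ltr_wpDl.
  have [y Wy xy] := h _ (divr_gt0 e0 C1); exists (f y) => //.
  rewrite -(linB fl); apply: le_trans (fb _) _.
  move: xy; rewrite ler_pdivlMr // => xy; have := ler_norm C; have := nrm_ge0 (x - y).
  by nra.
Qed.

Lemma closed_subspace_star (D : cstarAlgType R) (W : set D) :
  closed_subspace W -> closed_subspace [set d | W d /\ W (star d)].
Proof.
move=> [W0 WD Wc]; split=> [|k x y [Wx Wx'] [Wy Wy']|x h] /=.
- by rewrite stars0.
- by rewrite starD starZc; split; exact: WD.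
- split; apply: Wc => e /h[y [Wy Wy'] xy]; first by exists y.
  by exists (star y) => //; rewrite -starB nrm_star.
Qed.

(** A family acts nondegenerately as soon as the closed right ideal that it
generates contains the generators of the algebra and their adjoints. *)
Lemma nondegenerate_generated (I : Type) (D : cstarAlgType R) (f : I -> D) (A : set D) :
  let W := closure (lin_span [set x | exists i d, x = f i ** d]) in
  cstar_generated A = setT -> (forall x, A x -> W x /\ W (star x)) ->
  Defs.nondegenerate (fun i => to_mult (f i)).
Proof.
move=> W AT AW.
have Wsub : closed_subspace W := closure_span_subspace _.
have Wright x d : W x -> W (x ** d).
  move=> /closure_nrmP h; apply/closure_nrmP => e e0.
  have d1 : 0 < nrm d + 1 by rewrite ltr_wpDl ?nrm_ge0.
  have [y sy xy] := h _ (divr_gt0 e0 d1); exists (y ** d).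
    elim/lin_span_ind: sy {xy} => [|k _ z [i [c ->]] IH]; first by rewrite smul0r; exact: lin_span0.
    by rewrite smulDl smulZl -smulA; apply: lin_span_cons => //; exists i, (c ** d).
  rewrite -smulBl; apply: le_trans (nrmM _ _) _.
  by move: xy; rewrite ler_pdivlMr //; have := nrm_ge0 (x - y); nra.
have [V0 VD Vc] := closed_subspace_star Wsub.
apply/seteqP; split=> // x _.
suff h : forall x, [set d | W d /\ W (star d)] x by have [] := h x.
apply: (cstar_generated_ind AT) => //; split=> //.
- by move=> a b [Wa Wa'] [Wb Wb'] /=; rewrite starM; split; exact: Wright.
- by move=> a [Wa Wa'] /=; rewrite starK.
- by move=> a /closure_nrmP h; apply: Vc.
Qed.

Lemma mult_trivial (D : cstarAlgType R) (m n : multiplier D) :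
  (forall d : D, d = 0) -> m = n.
Proof.
by move=> D0; apply: multiplier_eql => d; rewrite (D0 (lmult m d)) (D0 (lmult n d)).
Qed.

Lemma mult_ext_ex (A D : cstarAlgType R) (f : A -> multiplier D) m :
  (exists n : multiplier D, forall a, n ** f a = f (lmult m a)) ->
  forall a, mult_ext f m ** f a = f (lmult m a).
Proof. exact: (@xgetPex _ 0 [set n | forall a, n ** f a = f (lmult m a)]). Qed.

(** The default value of mult_ext is 0, so a nonzero value has the defining
property. *)
Lemma mult_ext_neq0 (A D : cstarAlgType R) (f : A -> multiplier D) m :
  mult_ext f m <> 0 -> forall a, mult_ext f m ** f a = f (lmult m a).
Proof.
rewrite /mult_ext; case: xgetP => [n -> nP _ //|_ h]; by case: h.
Qed.

Lemma unitary_neq0 (D : cstarAlgType R) (u : multiplier D) :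
  star u ** u = mult_one -> u = 0 -> forall d : D, d = 0.
Proof.
move=> uu u0 d; have <- : lmult (star u ** u) d = d by rewrite uu.
by rewrite u0 muls0.
Qed.

Lemma unitary_opb (D : cstarAlgType R) (u : multiplier D) :
  star u ** u = mult_one -> opb u 1.
Proof. by move=> uu; apply: opb_cstar => //; rewrite uu expr1n; exact: opb1. Qed.

Lemma mult_ext_unitary (A D : cstarAlgType R) (f : A -> multiplier D) u :
  is_starhom f -> Defs.nondegenerate f ->
  star u ** u = mult_one -> u ** star u = mult_one ->
  opb (mult_ext f u) 1 /\ forall a, mult_ext f u ** f a = f (lmult u a).
Proof.
move=> fh fn u1 u2; have [n n1 nP] := unitary_extension fh fn u1 u2.
have h : forall a, mult_ext f u ** f a = f (lmult u a) by apply: mult_ext_ex; exists n.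
split=> //; suff -> : mult_ext f u = n by [].
by apply: (nondegenerate_eq fn) => a; rewrite h nP.
Qed.

(** For surjective [f] the defining property of mult_ext f m has at most one
solution, so any solution is its value. *)
Lemma mult_ext_onto (A D : cstarAlgType R) (f : A -> D) m (n : multiplier D) :
  (forall d, exists a, f a = d) -> (forall a, lmult n (f a) = f (lmult m a)) ->
  mult_ext (fun a => to_mult (f a)) m = n.
Proof.
move=> f_onto nP.
have nP' a : n ** to_mult (f a) = to_mult (f (lmult m a)) by rewrite lmult_to_mult nP.
have h := mult_ext_ex (ex_intro _ n nP').
apply: multiplier_eql => d; have [a <-] := f_onto d.
by apply: to_mult_inj; rewrite -!lmult_to_mult h nP'.
Qed.

Lemma closure_range_subalg (A D : cstarAlgType R) (f : A -> D) :
  is_starhom f -> is_cstar_subalg (closure (range f)).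
Proof.
move=> [fl fM fs].
have approx x : closure (range f) x -> forall e : R, 0 < e -> exists a, nrm (x - f a) <= e.
  by move=> /closure_nrmP h e /h[_ [a _ <-] xa]; exists a.
split.
- by apply: subset_closure; exists 0; rewrite ?(lin0 fl).
- move=> k x y /approx hx /approx hy; apply/closure_nrmP => e e0.
  have k1 : 0 < nrm k + 1 by rewrite ltr_wpDl ?nrm_ge0.
  have [a xa] := hx _ (divr_gt0 e0 k1); have [b yb] := hy _ (divr_gt0 e0 k1).
  exists (f (k *: a + b)); first by exists (k *: a + b).
  rewrite fl opprD addrACA -scalerBr; apply: le_trans (nrmD _ _) _.
  rewrite nrmZ; move: xa yb; rewrite !ler_pdivlMr //.
  have := nrm_ge0 k; nra.
- move=> x y /approx hx /approx hy; apply/closure_nrmP => e e0.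
  pose M := nrm x + nrm y + 1.
  have M0 : 0 < M by rewrite ltr_wpDl ?addr_ge0 ?nrm_ge0.
  pose r := Num.min 1 (e / M).
  have r0 : 0 < r by rewrite lt_min ltr01 divr_gt0.
  have r1 : r <= 1 by rewrite ge_min lexx.
  have rM : r * M <= e by rewrite -ler_pdivlMr // ge_min lexx orbT.
  have [a xa] := hx _ r0; have [b yb] := hy _ r0.
  exists (f (a ** b)); first by exists (a ** b).
  rewrite fM; have -> : x ** y - f a ** f b = (x - f a) ** f b + x ** (y - f b).
    by rewrite smulBl smulBr [RHS]addrC subrKA.
  apply: le_trans (nrmD _ _) _; apply: le_trans (lerD (nrmM _ _) (nrmM _ _)) _.
  have fb : nrm (f b) <= nrm y + 1.
    by have := nrmB y (y - f b); rewrite subKr; lra.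
  apply: le_trans rM; rewrite /M.
  have := ler_pM (nrm_ge0 _) (nrm_ge0 _) xa fb.
  have := ler_wpM2l (nrm_ge0 x) yb; lra.
- move=> x /approx hx; apply/closure_nrmP => e /hx[a xa].
  by exists (f (star a)); [exists (star a) | rewrite fs -starB nrm_star].
- exact: closed_closure.
Qed.

End Nondegeneracy.

(** * From a representation of (E, G, phi) to the crossed product *)

Section Representation.
Variables (R : realType) (G : groupType) (E : digraph) (act : graph_action G E).
Variables (phi : G -> edge E -> G) (D : cstarAlgType R).
Variables (P : vertex E -> D) (S : edge E -> D) (U : G -> multiplier D).
Hypothesis HD : is_representation act phi P S U.

Let PS_family : is_toeplitz_family P S := let: And5 h _ _ _ _ := HD in h.

Lemma rep1 : U 1%g = mult_one.
Proof. by case: HD => _ []. Qed.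

Lemma repM g h : U (g * h)%g = U g ** U h.
Proof. by case: HD => _ []. Qed.

Lemma rep_unitary g : star (U g) ** U g = mult_one.
Proof. by case: HD => _ [_ _ /(_ g)[]]. Qed.

Lemma repV g : star (U g) = U g^-1%g.
Proof. by rewrite -[LHS]mulm1 -rep1 -(divgg g) repM smulA rep_unitary mul1m. Qed.

Lemma rep_proj g v : U g ** to_mult (P v) = to_mult (P (actv act g v)) ** U g.
Proof. by rewrite lmult_to_mult rmult_to_mult; case: HD => _ _ ->. Qed.

Lemma rep_isom g e :
  U g ** to_mult (S e) = to_mult (S (acte act g e)) ** U (phi g e).
Proof. by rewrite lmult_to_mult rmult_to_mult; case: HD => _ _ _ ->. Qed.

Lemma actvK g v : actv act g (actv act g^-1%g v) = v.
Proof. by rewrite -actvM divgg actv1. Qed.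

Lemma actvKV g v : actv act g^-1%g (actv act g v) = v.
Proof. by rewrite -actvM mulVg actv1. Qed.

(** The adjoints of P_v U_g and S_e U_g begin with a projection P_w because
P_v U_g = U_g P_w for w = g^-1 v, and S_e = S_e P_{s(e)}. *)
Lemma rep_nondegenerate : Defs.nondegenerate (fun v => to_mult (P v)).
Proof.
have [_ _ _ _ gens] := HD.
apply: (nondegenerate_generated gens) => x.
set W := closure _.
have inW v d : W (P v ** d) by apply: subset_closure; apply: lin_span1; exists v, d.
have PU g v : rmult (U g) (P v) = lmult (U g) (P (actv act g^-1%g v)).
  by apply: to_mult_inj; rewrite -lmult_to_mult -rmult_to_mult rep_proj actvK.
have rmultE m (a b : D) : rmult m (a ** b) = a ** rmult m b.
  by apply: to_mult_inj; rewrite -rmult_to_mult !to_multM -rmult_to_mult smulA.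
have starPU g v : W (star (rmult (U g) (P v))).
  rewrite PU -[P (actv act g^-1%g v)](proj_idem PS_family) lmult_smul starM.
  by rewrite (proj_star PS_family); exact: inW.
case=> [[v [g ->]]|[e [g ->]]].
  by split=> //; rewrite -(proj_idem PS_family) rmultE.
split; first by rewrite -(proj_rng PS_family) rmultE.
rewrite -(isom_src PS_family) rmultE PU -[P (actv act _ _)](proj_idem PS_family).
by rewrite lmult_smul smulA starM (proj_star PS_family).
Qed.

Lemma rep_dense_span :
  closure (lin_span [set x : D | exists v d, x = P v ** d]) = setT.
Proof. exact: rep_nondegenerate. Qed.

Lemma nrm_rmult m r (d : D) : opb m r -> nrm (rmult m d) <= r * nrm d.
Proof.
move=> /opb_star[_ /(_ (star d))] /=; rewrite starK !nrm_star.
by [].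
Qed.

Lemma c0_act_delta g v : c0_act act g (c0_delta R v) = c0_delta R (actv act g v).
Proof.
apply: c0_eq => x /=.
suff -> : (actv act g^-1%g x == v) = (x == actv act g v) by [].
by apply/eqP/eqP => [<-|->]; rewrite ?actvK ?actvKV.
Qed.

(** The representation of c_0(E^0) determined by the projections P_v. *)
Lemma covariant_representation : exists pi : c0 R (vertex E) -> D,
  [/\ is_covariant (c0_act act) (fun a => to_mult (pi a)) U,
      forall v, pi (c0_delta R v) = P v
    & forall a v, pi a ** P v = a v *: P v].
Proof.
have [pi [pih pid piP pib]] :=
  c0_representation (proj_star PS_family) (proj_mul PS_family).
have [pil piM pis] := pih.
exists pi; split=> //; split.
- split=> [k a b|a b|a].
  + by rewrite pil to_multD to_multZ.
  + by rewrite piM to_multM.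
  + by rewrite pis to_mult_star.
- apply/seteqP; split=> // x _.
  have : closure (lin_span [set x : D | exists v d, x = P v ** d]) x.
    by rewrite rep_dense_span.
  apply: closureS => {}x; elim/lin_span_ind => [|k _ y [v [d ->]] IH].
    exact: lin_span0.
  by apply: lin_span_cons => //; exists (c0_delta R v), d; rewrite pid.
- by case: HD.
- move=> g a; rewrite lmult_to_mult rmult_to_mult; congr to_mult; move: a.
  apply: (dense_eq ler01 (@c0_dense R (vertex E))).
  + by move=> k x y; rewrite -pil; congr (pi _); apply: c0_eq.
  + by move=> k x y; rewrite pil lmultD lmultZ rmultD rmultZ.
  + move=> a; rewrite mul1r; apply: le_trans (pib _) _.
    by apply: c0norm_le => [|v]; [exact: c0norm_ge0 | exact: (nrm_le_c0norm a)].
  + have Ug1 : opb (U g) 1 by apply: unitary_opb; exact: rep_unitary.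
    move=> a; apply: le_trans (nrm_rmult _ (opb_star Ug1)) _; rewrite !mul1r.
    by case: Ug1 => _ /(_ (pi a)); rewrite mul1r => /le_trans; apply.
  + move=> _ [v ->]; rewrite c0_act_delta !pid; apply: to_mult_inj.
    rewrite -rmult_to_mult -lmult_to_mult rep_proj -smulA repV -repM divgg rep1.
    by rewrite mulm1.
Qed.

Section CrossedProduct.
Variables (B : cstarAlgType R).
Variables (iA : c0 R (vertex E) -> multiplier B) (iG : G -> multiplier B).
Hypothesis HB : is_crossed_product (c0_act (R := R) act) iA iG.

(** The integrated form L of the covariant pair takes its values in D, not only in
M(D), since it sends i_A(a) i_G(g) to pi(a) U_g and these elements span B densely.
The relation pi(a) L(b) = L(i_A(a) b) is read off mult_ext where pi(a) <> 0; where
pi(a) = 0 it is the difference of the relations for a + a' and a', with pi(a') <> 0.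
If pi vanishes identically then D = 0 by nondegeneracy. *)
Lemma integrated_form (pi : c0 R (vertex E) -> D) :
  is_covariant (c0_act act) (fun a => to_mult (pi a)) U ->
  exists zeta : B -> D, is_starhom zeta /\
    forall a g b, to_mult b = iA a ** iG g -> zeta b = rmult (U g) (pi a).
Proof.
move=> cov; have [[[iAl _ _] _ _ _] iAG dB univ] := HB.
have [L [Lh Ln LA LG]] := univ D _ U cov.
have [Ll LM Ls] := Lh.
have [[pil _ _] pin _ _] := cov.
have LG' g b : U g ** L b = L (lmult (iG g) b).
  have [U0|U0] := pselect (U g = 0).
    by apply: mult_trivial; exact: (unitary_neq0 (rep_unitary g) U0).
  by rewrite -(LG g) mult_ext_neq0 // LG.
have LA' a b : to_mult (pi a) ** L b = L (lmult (iA a) b).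
  have ne a' : pi a' <> 0 -> to_mult (pi a') ** L b = L (lmult (iA a') b).
    move=> a0; rewrite -(LA a') mult_ext_neq0 // LA => h.
    by apply: a0; apply: to_mult_inj; rewrite h to_mult0.
  have [[a' a'0]|all0] := pselect (exists a', pi a' <> 0).
    have [a0|a0] := pselect (pi a = 0); last exact: ne.
    have pilin : linear pi.
      by move=> k x y; apply: to_mult_inj; rewrite pil to_multD to_multZ.
    have aa : pi (a + a') <> 0 by rewrite (linD pilin) a0 add0r.
    have := ne _ aa; rewrite (linD pilin) to_multD smulDl (ne a') //.
    by rewrite (linD iAl) lmultDl (linD Ll) => /addIr.
  apply: mult_trivial => d; have : closure (lin_span [set x : D | exists a c, x = lmult (to_mult (pi a)) c]) d.
    by rewrite pin.
  move=> /closure_nrmP h; apply: nrm_eps0 => e /h[y sy]; suff -> : y = 0 by rewrite subr0.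
  elim/lin_span_ind: sy => // k _ z [a' [c ->]] ->.
  have -> : pi a' = 0 by apply: contrapT => a'0; apply: all0; exists a'.
  by rewrite to_mult0 lmult0l scaler0 addr0.
have Lgen a g b : to_mult b = iA a ** iG g -> L b = to_mult (rmult (U g) (pi a)).
  move=> bE; rewrite -rmult_to_mult; apply: (nondegenerate_eq Ln) => b'.
  rewrite -smulA LG' LA' -LM; congr L.
  by have := congr1 (fun m => lmult m b') bE.
have [zeta zP] : exists zeta : B -> D, forall b, to_mult (zeta b) = L b.
  suff h b : exists d, to_mult d = L b by have [z zP] := choice h; exists z.
  apply: (closed_subspace_dense dB (W := [set b | exists d, to_mult d = L b])).
    split=> [|k x y [d dx] [d' dy]|x h] /=.
    - by exists 0; rewrite to_mult0 (lin0 Ll).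
    - by exists (k *: d + d'); rewrite Ll -dx -dy to_multD to_multZ.
    - pose q : R := 2^-1; have q0 : 0 < q by rewrite invr_gt0.
      have q1 : q < 1 by rewrite invf_lt1 ?ltr1n.
      have /choice[p pP] n : exists p : B * D, to_mult p.2 = L p.1 /\ nrm (x - p.1) <= q ^+ n.
        by have [y [d dy] xy] := h _ (exprn_gt0 n q0); exists (y, d).
      have [d ->] : exists d, L x = to_mult d; last by exists d.
      apply: (@mcvg_elt _ _ (fun n => (p n).2)) => e e0.
      have e2 : 0 < e / 2 by rewrite divr_gt0.
      have [N hN] := expr_small (ltW q0) q1 e2.
      exists N => n /hN qn; have [-> xn] := pP n; rewrite -(linB Ll).
      apply: opb_le (mult_starhom_bounded Lh _) _.
      by move: xn; lra.
  move=> {}b [a [g bE]] /=; exists (rmult (U g) (pi a)); by rewrite (Lgen a g).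
exists zeta; split; last first.
  by move=> a g b /Lgen bE; apply: to_mult_inj; rewrite zP.
split.
- by move=> k a b; apply: to_mult_inj; rewrite to_multD to_multZ !zP Ll.
- by move=> a b; apply: to_mult_inj; rewrite to_multM !zP LM.
- by move=> a; apply: to_mult_inj; rewrite to_mult_star !zP Ls.
Qed.

End CrossedProduct.

End Representation.

(** * The Toeplitz representation of the graph correspondence *)

Section GraphCorrespondence.
Variables (R : realType) (G : groupType) (E : digraph) (act : graph_action G E).
Variables (phi : G -> edge E -> G) (B : cstarAlgType R).
Variables (iA : c0 R (vertex E) -> multiplier B) (iG : G -> multiplier B).
Variables (Y : correspondence B) (chi : edge E -> G -> Y).
Hypothesis Hphi : is_cocycle act phi.
Hypothesis HB : is_crossed_product (c0_act (R := R) act) iA iG.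
Hypothesis HY : is_graph_correspondence act phi iA iG chi.

Lemma cocycle1 e : phi 1%g e = 1%g.
Proof.
have := Hphi.1 1%g 1%g e; rewrite mulg1 acte1 => h.
by apply: (mulgI (phi 1%g e)); rewrite -h mulg1.
Qed.

Lemma crossed_unitary g : star (iG g) ** iG g = mult_one /\ iG g ** star (iG g) = mult_one.
Proof. by case: HB => [[_ _ [_ _ h] _]]. Qed.

Lemma iA_starhom : is_starhom iA.
Proof. by case: HB => [[]]. Qed.

Lemma iG1 : iG 1%g = mult_one.
Proof. by case: HB => [[_ _ []]]. Qed.

Lemma iG_iA g a : iG g ** iA a = iA (c0_act act g a) ** iG g.
Proof.
have [[_ _ _ ->] _ _ _] := HB.
by rewrite -smulA (crossed_unitary g).1 mulm1.
Qed.

Lemma delta_spec v g : to_mult (delta iA iG v g) = iA (c0_delta R v) ** iG g.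
Proof.
have [_ /(_ (c0_delta R v) g)[b bE] _ _] := HB.
by rewrite /delta (mult_eltK bE).
Qed.

Lemma elt_iA a : to_mult (mult_elt (iA a)) = iA a.
Proof.
have [_ /(_ a 1%g)[b bE] _ _] := HB; rewrite iG1 mulm1 in bE.
by rewrite (mult_eltK bE).
Qed.

Lemma chi_left_unit e h : lact (delta iA iG (rng e) 1%g) (chi e h) = chi e h.
Proof.
have [_ _ _ ->] := HY.
by rewrite acte1 eqxx cocycle1 mul1g.
Qed.

Lemma chi_right_unit e g : ract (chi e 1%g) (delta iA iG (src e) g) = chi e g.
Proof. by have [_ _ -> _] := HY; rewrite actv1 eqxx mul1g. Qed.

(** The unit delta_{r(e),1} of chi_{e,h} absorbs i_A(a): only its value at
g r(e) is seen, and no continuity of i_A is involved. *)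
Lemma lact_chi a g b e h : to_mult b = iA a ** iG g ->
  lact b (chi e h) = a (actv act g (rng e)) *: chi (acte act g e) (phi g e * h)%g.
Proof.
move=> bE; rewrite -{1}chi_left_unit -lactM; set w := actv act g (rng e).
have [iAl iAM _] := iA_starhom.
have -> : b ** delta iA iG (rng e) 1 = a w *: delta iA iG w g.
  apply: to_mult_inj; rewrite to_multM to_multZ bE !delta_spec iG1 mulm1 -smulA.
  by rewrite iG_iA c0_act_delta smulA -iAM c0_delta_mul (linZ iAl) smulZl.
have -> : lact (a w *: delta iA iG w g) (chi e h) = a w *: lact (delta iA iG w g) (chi e h).
  exact: (linZ (lact_linearl (chi e h))).
by have [_ _ _ ->] := HY; rewrite rng_act eqxx.
Qed.

Lemma chi_dense : dense_for (fun y : Y => nrm y) [set y | exists e g, y = chi e g].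
Proof. by apply: dense_nrm; case: HY. Qed.

Lemma crossed_dense :
  closure (lin_span [set b : B | exists a g, to_mult b = iA a ** iG g]) = setT.
Proof. by case: HB. Qed.

(** On the generators chi_{e,g} |-> S_e U_g, inner products are respected because
S_e* S_f = 0 for e <> f and S_e* S_e = P_{s(e)}.  This makes the map bounded, hence
extendable, and both Toeplitz relations extend from generators by continuity. *)
Lemma psi_exists (D : cstarAlgType R)
    (P : vertex E -> D) (S : edge E -> D) (U : G -> multiplier D)
    (pi : c0 R (vertex E) -> D) (zeta : B -> D) :
  is_representation act phi P S U ->
  (forall v, pi (c0_delta R v) = P v) -> (forall a v, pi a ** P v = a v *: P v) ->
  is_starhom zeta ->
  (forall a g b, to_mult b = iA a ** iG g -> zeta b = rmult (U g) (pi a)) ->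
  exists psi : Y -> D, is_toeplitz_rep psi zeta /\
    forall e g, psi (chi e g) = rmult (U g) (S e).
Proof.
move=> HD piE piP zh zE; have [zl zM zs] := zh.
have PS_family : is_toeplitz_family P S by case: HD.
have zb := starhom_bounded zh.
have zdelta v g : to_mult (zeta (delta iA iG v g)) = to_mult (P v) ** U g.
  by rewrite (zE _ _ _ (delta_spec v g)) piE rmult_to_mult.
pose gen (y : Y) (d : D) := exists e g, y = chi e g /\ d = rmult (U g) (S e).
have gen_ip y d y' d' : gen y d -> gen y' d' -> star d ** d' = zeta (ip y y').
  move=> [e [g [-> ->]]] [f [h [-> ->]]]; have [_ -> _ _] := HY.
  apply: to_mult_inj; rewrite to_multM to_mult_star -!rmult_to_mult starM.
  rewrite -to_mult_star smulA -[_ ** to_mult (S f)]smulA -to_multM.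
  case: eqVneq => [<-|ef]; last first.
    by rewrite (isom_orth PS_family ef) to_mult0 muls0 mul0s (lin0 zl) to_mult0.
  rewrite (isom_initial PS_family) (repV HD) (rep_proj HD) zdelta.
  by rewrite -smulA -(repM HD).
have ip_zeta y d y' d' : linpair gen y d -> linpair gen y' d' ->
    star d ** d' = zeta (ip y y').
  elim=> [|{}y {}d yd|k y1 d1 y2 d2 _ IH1 _ IH2] yd'.
  - by rewrite stars0 mul0s -(scale0r (0 : Y)) ipZl rmorph0 scale0r (lin0 zl).
  - elim: yd' => [|{}y' {}d' yd'|k y1 d1 y2 d2 _ IH1 _ IH2].
    + by rewrite muls0 -(scale0r (0 : Y)) ipZr scale0r (lin0 zl).
    + exact: gen_ip.
    + by rewrite smulDr smulZr IH1 IH2 ipDr ipZr zl.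
  - by rewrite starD starZc smulDl smulZl IH1 // IH2 // ipDl ipZl zl.
have [|||psi [pl pg pb]] := @bounded_extension R Y _ D gen 2 (@nrm_seminorm R Y).
- by [].
- move=> y d yd; rewrite -(@ler_pXn2r _ 2) ?nnegrE ?mulr_ge0 ?nrm_ge0 //.
  rewrite -nrm_cstar (ip_zeta _ _ _ _ yd yd); apply: le_trans (zb _) _.
  by rewrite -nrm_ip_sqr; have := exprn_ge0 2 (nrm_ge0 y); lra.
- move=> y r r0; have [y' sy yy] := chi_dense y r0; exists y' => //.
  elim/lin_span_ind: sy {yy} => [|k _ z [e [g ->]] IH]; first exact: lin_span0.
  by apply: lin_span_cons => //; exists (rmult (U g) (S e)), e, g.
have pchi e g : psi (chi e g) = rmult (U g) (S e) by apply: pg; exists e, g.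
exists psi; split=> //; split=> //.
- (* first for x = chi e g and all y, then by taking adjoints for all x and y *)
  have half e g y : star (psi (chi e g)) ** psi y = zeta (ip (chi e g) y).
    move: y; apply: (dense_eq (C := nrm (psi (chi e g)) * 2 + 2 * (4 * nrm (chi e g))) _ chi_dense).
    + by rewrite addr_ge0 ?mulr_ge0 ?nrm_ge0.
    + by move=> k x z; rewrite pl smulDr smulZr.
    + by move=> k x z; rewrite ip_linear zl.
    + move=> x; apply: le_trans (nrmM _ _) _; rewrite nrm_star.
      have := pb x; have := nrm_ge0 x; have := nrm_ge0 (chi e g).
      have := nrm_ge0 (psi (chi e g)); nra.
    + move=> x; apply: le_trans (zb _) _.
      have := nrm_ip (chi e g) x; have := nrm_ge0 x; have := nrm_ge0 (chi e g).
      have := nrm_ge0 (psi (chi e g)); nra.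
    + by move=> x [f [h ->]]; apply: gen_ip; [exists e, g | exists f, h].
  move=> x y; rewrite -[LHS]starK -[RHS]starK; congr star.
  rewrite starM starK -zs ip_star; move: x.
  apply: (dense_eq (C := nrm (psi y) * 2 + 2 * (4 * nrm y)) _ chi_dense).
  + by rewrite addr_ge0 ?mulr_ge0 ?nrm_ge0.
  + by move=> k x z; rewrite pl smulDr smulZr.
  + by move=> k x z; rewrite ip_linear zl.
  + move=> x; apply: le_trans (nrmM _ _) _; rewrite nrm_star.
    have := pb x; have := nrm_ge0 x; have := nrm_ge0 y; have := nrm_ge0 (psi y); nra.
  + move=> x; apply: le_trans (zb _) _.
    have := nrm_ip y x; have := nrm_ge0 x; have := nrm_ge0 y; have := nrm_ge0 (psi y); nra.
  + by move=> x [e [g ->]]; rewrite -[LHS]starK starM starK half -zs ip_star.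
- have on_gen b : [set b : B | exists a g, to_mult b = iA a ** iG g] b ->
      forall x, zeta b ** psi x = psi (lact b x).
    move=> [a [g bE]].
    apply: (dense_eq (C := nrm (zeta b) * 2 + 2 * (2 * nrm b)) _ chi_dense).
    + by rewrite addr_ge0 ?mulr_ge0 ?nrm_ge0.
    + by move=> k x z; rewrite pl smulDr smulZr.
    + by move=> k x z; rewrite lact_linearr pl.
    + move=> x; apply: le_trans (nrmM _ _) _.
      have := pb x; have := nrm_ge0 x; have := nrm_ge0 b; have := nrm_ge0 (zeta b); nra.
    + move=> x; apply: le_trans (pb _) _.
      have := lact_bounded b x; have := nrm_ge0 x; have := nrm_ge0 (zeta b); nra.
    + move=> _ [e [h ->]]; rewrite (lact_chi _ _ bE) (linZ pl) !pchi (zE _ _ _ bE).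
      apply: to_mult_inj; rewrite to_multM to_multZ -!rmult_to_mult smulA.
      rewrite -[to_mult (pi a) ** U g ** _]smulA (rep_isom HD) (repM HD) !smulA -to_multM.
      rewrite -!smulZl -to_multZ; congr (to_mult _ ** _ ** _).
      by rewrite -{1}(proj_rng PS_family) rng_act smulA piP smulZl -rng_act proj_rng.
  move=> b x; move: b.
  apply: (dense_eq (C := 2 * nrm (psi x) + 2 * (2 * nrm x)) _ (dense_nrm crossed_dense)).
  + by rewrite addr_ge0 ?mulr_ge0 ?nrm_ge0.
  + by move=> k b c; rewrite zl smulDl smulZl.
  + by move=> k b c; rewrite lact_linearl pl.
  + move=> b; apply: le_trans (nrmM _ _) _.
    have := zb b; have := nrm_ge0 x; have := nrm_ge0 b; have := nrm_ge0 (psi x); nra.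
  + move=> b; apply: le_trans (pb _) _.
    have := lact_bounded b x; have := nrm_ge0 b; have := nrm_ge0 (psi x); nra.
  + by move=> b bgen; exact: on_gen.
Qed.

End GraphCorrespondence.

(** * The canonical elements of the Toeplitz algebra *)

Section ToeplitzAlgebra.
Variables (R : realType) (G : groupType) (E : digraph) (act : graph_action G E).
Variables (phi : G -> edge E -> G) (B : cstarAlgType R).
Variables (iA : c0 R (vertex E) -> multiplier B) (iG : G -> multiplier B).
Variables (Y : correspondence B) (chi : edge E -> G -> Y).
Hypothesis Hphi : is_cocycle act phi.
Hypothesis HB : is_crossed_product (c0_act (R := R) act) iA iG.
Hypothesis HY : is_graph_correspondence act phi iA iG chi.
Variables (T : cstarAlgType R) (tY : Y -> T) (tB : B -> T).
Hypothesis HT : is_toeplitz_algebra tY tB.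

Let u (g : G) : multiplier T := mult_ext (fun b => to_mult (tB b)) (iG g).

Lemma toeplitz_tB : is_starhom tB.
Proof. by case: HT => [[]]. Qed.

Lemma toeplitz_tY_linear : linear tY.
Proof. by case: HT => [[]]. Qed.

Lemma toeplitz_tY_bounded y : nrm (tY y) <= 2 * nrm y.
Proof.
have [[_ _ ip_tB _] _ _] := HT.
rewrite -(@ler_pXn2r _ 2) ?nnegrE ?mulr_ge0 ?nrm_ge0 // -nrm_cstar ip_tB.
apply: le_trans (starhom_bounded toeplitz_tB _) _.
by rewrite -nrm_ip_sqr; have := exprn_ge0 2 (nrm_ge0 y); lra.
Qed.

Lemma toeplitz_ract y b : tY (ract y b) = tY y ** tB b.
Proof.
have [[tYl [tBl tBM tBs] ip_tB _] _ _] := HT.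
apply/eqP; rewrite -subr_eq0; apply/eqP/star_smul_eq0.
have zy z : star (tY z) ** (tY (ract y b) - tY y ** tB b) = 0.
  by rewrite smulBr smulA !ip_tB ip_ract tBM subrr.
by rewrite starB starM smulBl -smulA !zy muls0 subrr.
Qed.

(** B B spans B densely because i_A is nondegenerate and takes values in B; and each
chi_{e,g} is fixed by some delta_{v,1} on the left and by another one on the right. *)
Lemma toeplitz_nondegenerate : Defs.nondegenerate (fun b => to_mult (tB b)).
Proof.
have [[tYl tBh ip_tB tB_tY] gens _] := HT; have [tBl tBM tBs] := tBh.
apply: (nondegenerate_generated gens).
set W := closure _; have Wsub : closed_subspace W := closure_span_subspace _.
have inW b t : W (tB b ** t) by apply: subset_closure; apply: lin_span1; exists b, t.
have WB b : W (tB b).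
  have [[_ iAn _ _] _ _ _] := HB.
  apply: (closed_subspace_dense iAn
            (closed_subspace_preim tBl (starhom_bounded tBh) Wsub)).
  move=> _ [a [c ->]] /=; have -> : lmult (iA a) c = mult_elt (iA a) ** c.
    exact: (esym (congr1 (fun m => lmult m c) (elt_iA HB a))).
  by rewrite tBM.
move=> _ [[y _ <-]|[b _ <-]]; last by rewrite -tBs.
apply: (closed_subspace_dense (let: And4 h _ _ _ := HY in h) 
  (closed_subspace_preim tYl toeplitz_tY_bounded (closed_subspace_star Wsub))).
move=> _ [e [g ->]] /=; split.
  by rewrite -(chi_left_unit Hphi HY) -tB_tY.
rewrite -(chi_right_unit HY) toeplitz_ract starM -tBs.
exact: inW.
Qed.

Lemma canonical_unitary g : opb (u g) 1 /\
  forall b, lmult (u g) (tB b) = tB (lmult (iG g) b).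
Proof.
have [u1 u2] := crossed_unitary HB g.
have [ug1 ugP] := mult_ext_unitary (to_mult_starhom toeplitz_tB)
  toeplitz_nondegenerate u1 u2.
split=> // b; apply: to_mult_inj; rewrite -ugP /u.
by rewrite lmult_to_mult.
Qed.

Section Target.
Variables (D : cstarAlgType R).
Variables (P : vertex E -> D) (S : edge E -> D) (U : G -> multiplier D).
Hypothesis HD : is_representation act phi P S U.

(** Products t_B(b) t span T densely, and both sides are bounded and compatible
with right multiplication by t. *)
Lemma intertwine (Phi : T -> D) g : is_starhom Phi ->
  (forall b, Phi (tB (lmult (iG g) b)) = lmult (U g) (Phi (tB b))) ->
  forall t, Phi (lmult (u g) t) = lmult (U g) (Phi t).
Proof.
move=> Ph PhiU; have [Pl PM _] := Ph; have Pb := starhom_bounded Ph.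
have [[_ ub] ugB] := canonical_unitary g.
apply: (dense_eq (C := 2) _ (dense_nrm toeplitz_nondegenerate)) => //.
- by move=> k x y; rewrite lmultD lmultZ Pl.
- by move=> k x y; rewrite Pl lmultD lmultZ.
- by move=> x; apply: le_trans (Pb _) _; have := ub x; lra.
- move=> x; have [_ /(_ (Phi x))] := unitary_opb (rep_unitary HD g).
  by have := Pb x; lra.
- move=> _ [b [t ->]] /=.
  by rewrite lmult_smul ugB !PM PhiU lmult_smul.
Qed.

(** Multiplication by the P_w, which act nondegenerately, determines
Phi(i_A(a)) from the values Phi(p_w). *)
Lemma target_iA (Phi Psi : T -> D) : is_starhom Phi -> is_starhom Psi ->
  (forall v, Phi (tB (mult_elt (iA (c0_delta R v)))) = P v) ->
  (forall v, Psi (tB (mult_elt (iA (c0_delta R v)))) = P v) ->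
  forall a, Phi (tB (mult_elt (iA a))) = Psi (tB (mult_elt (iA a))).
Proof.
have key (Xi : T -> D) a w : is_starhom Xi ->
    (forall v, Xi (tB (mult_elt (iA (c0_delta R v)))) = P v) ->
    Xi (tB (mult_elt (iA a))) ** P w = a w *: P w.
  move=> [Xl XM _] XP; have [tBl tBM _] := toeplitz_tB.
  have [iAl iAM _] := iA_starhom HB.
  rewrite -(XP w) -XM -tBM -(linZ Xl) -(linZ tBl); congr (Xi (tB _)).
  apply: to_mult_inj; rewrite to_multM to_multZ !(elt_iA HB) -iAM c0_delta_mul.
  by rewrite (linZ iAl).
move=> Ph Ps PhP PsP a; apply: to_mult_inj.
apply: (nondegenerate_eq (rep_nondegenerate HD)) => v.
by rewrite -!to_multM !key.
Qed.

(** Since i_A(a) i_G(g) = i_G(g) i_A(g^-1 a), the products of u_g and t_B(i_A(a)) span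
t_B(B) densely; and t_Y(chi_{e,g}) = s_e t_B(delta_{s(e),g}).  So a homomorphism is
determined on the generators of T by its values on the p_v and s_e and by its
compatibility with the u_g. *)
Lemma target_unique (Phi Psi : T -> D) : is_starhom Phi -> is_starhom Psi ->
  (forall v, Phi (tB (mult_elt (iA (c0_delta R v)))) = P v) ->
  (forall v, Psi (tB (mult_elt (iA (c0_delta R v)))) = P v) ->
  (forall e, Phi (tY (chi e 1%g)) = S e) -> (forall e, Psi (tY (chi e 1%g)) = S e) ->
  (forall g t, Phi (lmult (u g) t) = lmult (U g) (Phi t)) ->
  (forall g t, Psi (lmult (u g) t) = lmult (U g) (Psi t)) ->
  Phi = Psi.
Proof.
move=> Ph Ps PhP PsP PhS PsS PhU PsU.
have [Phl PhM Phs] := Ph; have [Psl PsM Pss] := Ps.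
have [_ gens _] := HT; have [tBl tBM tBs] := toeplitz_tB.
have bound (Xi : T -> D) (V : completeNormedModType R[i]) (f : V -> T) :
    is_starhom Xi -> (forall x, nrm (f x) <= 2 * nrm x) ->
    forall x, nrm (Xi (f x)) <= 4 * nrm x.
  by move=> Xh fb x; have := fb x; have := starhom_bounded Xh (f x); lra.
have onB b : Phi (tB b) = Psi (tB b).
  have bB := starhom_bounded toeplitz_tB.
  move: b; apply: (dense_eq (C := 4) _ (dense_nrm (crossed_dense HB))) => //.
  - by move=> k x y; rewrite tBl Phl.
  - by move=> k x y; rewrite tBl Psl.
  - exact: bound.
  - exact: bound.
  - move=> b [a [g bE]].
    have -> : b = lmult (iG g) (mult_elt (iA (c0_act act g^-1%g a))).
      apply: to_mult_inj; rewrite bE -lmult_to_mult (elt_iA HB) (iG_iA HB).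
      congr (iA _ ** _); apply: c0_eq => v /=; congr (c0_fun a _).
      by rewrite invgK actvK.
    have [_ ugB] := canonical_unitary g.
    by rewrite -ugB PhU PsU (target_iA Ph Ps PhP PsP).
have onY y : Phi (tY y) = Psi (tY y).
  move: y; apply: (dense_eq (C := 4) _ (chi_dense HY)) => //.
  - by move=> k x y; rewrite toeplitz_tY_linear Phl.
  - by move=> k x y; rewrite toeplitz_tY_linear Psl.
  - by apply: bound => //; exact: toeplitz_tY_bounded.
  - by apply: bound => //; exact: toeplitz_tY_bounded.
  - move=> _ [e [g ->]].
    by rewrite -(chi_right_unit HY) toeplitz_ract PhM PsM PhS PsS onB.
apply/funext; apply: (cstar_generated_ind (N := [set t | Phi t = Psi t]) gens).
  split=> /=.
  - by rewrite (lin0 Phl) (lin0 Psl).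
  - by move=> k x y hx hy; rewrite Phl Psl hx hy.
  - by move=> x y hx hy; rewrite PhM PsM hx hy.
  - by move=> x hx; rewrite Phs Pss hx.
  - move=> x /closure_nrmP h; apply/eqP; rewrite -subr_eq0; apply/eqP/nrm_eps0 => e e0.
    have e4 : 0 < e / 4 by rewrite divr_gt0.
    have [y /= yE xy] := h _ e4.
    have -> : Phi x - Psi x = Phi (x - y) - Psi (x - y).
      by rewrite (linB Phl) (linB Psl) yE opprB subrKA.
    apply: le_trans (nrmB _ _) _.
    by have := starhom_bounded Ph (x - y); have := starhom_bounded Ps (x - y); lra.
by move=> _ [[y _ <-]|[b _ <-]].
Qed.

End Target.

End ToeplitzAlgebra.

Theorem theorem5p2 (R : realType) (G : groupType) (E : digraph)
    (act : graph_action G E) (phi : G -> edge E -> G)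
    (Hphi : is_cocycle act phi)
    (B : cstarAlgType R)
    (iA : c0 R (vertex E) -> multiplier B) (iG : G -> multiplier B)
    (HB : is_crossed_product (c0_act (R := R) act) iA iG)
    (Y : correspondence B) (chi : edge E -> G -> Y)
    (HY : is_graph_correspondence act phi iA iG chi)
    (T : cstarAlgType R) (tY : Y -> T) (tB : B -> T)
    (HT : is_toeplitz_algebra tY tB)
    (D : cstarAlgType R)
    (P : vertex E -> D) (S : edge E -> D) (U : G -> multiplier D)
    (HD : is_representation act phi P S U) :
  let p := fun v => tB (mult_elt (iA (c0_delta R v))) in
  let s := fun e => tY (chi e 1%g) in
  let u := fun g => mult_ext (fun b => to_mult (tB b)) (iG g) in
  exists! Phi : T -> D,
    [/\ is_starhom Phi, set_surj setT setT Phi,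
        forall v, Phi (p v) = P v,
        forall e, Phi (s e) = S e
      & forall g, mult_ext (fun x => to_mult (Phi x)) (u g) = U g].
Proof.
move=> p s u.
have [pi [cov piE piP]] := covariant_representation HD.
have [zeta [zh zE]] := integrated_form HD HB cov.
have [psi [tr psiE]] := psi_exists Hphi HB HY HD piE piP zh zE.
have [_ _ /(_ D psi zeta tr)[Phi [Ph PhY PhB]]] := HT.
have Phs e : Phi (s e) = S e.
  by rewrite PhY psiE; apply: to_mult_inj; rewrite -rmult_to_mult (rep1 HD) mulm1.
have Php v : Phi (p v) = P v.
  rewrite PhB (zE (c0_delta R v) 1%g); last by rewrite (elt_iA HB) (iG1 HB) mulm1.
  by rewrite piE (rep1 HD).
have PhG g b : Phi (tB (lmult (iG g) b)) = lmult (U g) (Phi (tB b)).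
  rewrite !PhB; have [[pil _ _] _ _ covU] := cov; have [zl _ _] := zh.
  have bz := starhom_bounded zh.
  have [_ ig] := unitary_opb (crossed_unitary HB g).1.
  have [_ Ug] := unitary_opb (rep_unitary HD g).
  move: b; apply: (dense_eq (C := 2) _ (dense_nrm (crossed_dense HB))) => //.
  - by move=> k x y; rewrite lmultD lmultZ zl.
  - by move=> k x y; rewrite zl lmultD lmultZ.
  - by move=> x; apply: le_trans (bz _) _; have := ig x; lra.
  - by move=> x; have := Ug (zeta x); have := bz x; lra.
  - move=> b [a [h bE]]; rewrite (zE _ _ _ bE).
    rewrite (zE (c0_act act g a) (g * h)%g); last first.
      rewrite -lmult_to_mult bE smulA (iG_iA HB) -smulA; congr (_ ** _).
      by have [[_ _ [_ -> _] _] _ _ _] := HB.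
    apply: to_mult_inj; rewrite -lmult_to_mult -!rmult_to_mult covU (repM HD).
    by rewrite !smulA -[_ ** star (U g) ** U g]smulA (rep_unitary HD) mulm1.
have PhU g t : Phi (lmult (u g) t) = lmult (U g) (Phi t).
  exact: (intertwine Hphi HB HY HT HD).
(* The range contains the generators P_v U_g and S_e U_g of D. *)
have Ph_onto d : exists t, Phi t = d.
  apply: (dense_range_onto Ph); have [_ _ _ _ gens] := HD.
  apply/seteqP; split=> // x _.
  apply: (cstar_generated_ind gens (closure_range_subalg Ph)) => _ [[v [g ->]]|[e [g ->]]].
  - apply: subset_closure; exists (tB (delta iA iG v g)) => //.
    by rewrite PhB (zE _ _ _ (delta_spec HB v g)) piE.
  - by apply: subset_closure; exists (tY (chi e g)); rewrite // PhY psiE.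
exists Phi; split.
  split=> //; first by move=> d _; have [t <-] := Ph_onto d; exists t.
  by move=> g; apply: mult_ext_onto.
move=> Psi [Psh Ps_surj Psp Pss Psu].
have PsU g t : Psi (lmult (u g) t) = lmult (U g) (Psi t).
  (* If U g = 0 then D = 0; otherwise mult_ext does not take its default value. *)
  have [U0|U0] := pselect (U g = 0).
    have D0 := unitary_neq0 (rep_unitary HD g) U0.
    by rewrite (D0 (Psi _)) (D0 (lmult _ _)).
  apply: to_mult_inj; rewrite -(lmult_to_mult (U g)) -(Psu g) mult_ext_neq0 //.
  by rewrite Psu.
exact: (target_unique Hphi HB HY HT HD).
Qed.
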